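(* Let $W$ be a simply laced finite Weyl group with nonempty set of simple reflections $\{s_i; i\in I\}$, and let $\nu$ be the maximal value of the length function on $W$. Let $\mathbf{k}$ be a totally ordered field and let $\mathbf{k}_{>0}$ be its subset of positive elements, regarded as a semifield with the usual operations $+,\times$. Let $\mathcal{B}_{\mathbf{k}_{>0}}$ be the flag manifold over the semifield $\mathbf{k}_{>0}$ attached to $W$, viewed as a graph in which two points $B\neq B'$ are joined by an edge if and only if there exist $i\in I$ and a half $i$-circle of $\mathcal{B}_{\mathbf{k}_{>0}}$ containing both $B$ and $B'$. If $B,B'$ are in $\mathcal{B}_{\mathbf{k}_{>0}}$, then $B,B'$ are at distance $\le2\nu-1$. In particular, the graph $\mathcal{B}_{\mathbf{k}_{>0}}$ is connected.
   Context: **Semifields.** A semifield is a set $K$ with two operations $+,\times$ such that $(K,\times)$ is an abelian group, $(K,+)$ is a commutative semigroup and $\times$ distributes over $+$. The definitions below are for a general semifield $K$; here they are applied with $K=\mathbf{k}_{>0}$. **Weyl group data.** For $i,j\in I$ put $i.j=-1$ if $i\ne j$ and $s_is_js_i=s_js_is_j$; $i.j=0$ if $i\neq j$ and $s_is_j=s_js_i$; $i.j=2$ if $i=j$. Let $|\cdot|$ be the length function on $W$, $w_0$ the unique element of $W$ of maximal length $\nu$, and $\mathcal{I}$ the set of all sequences $\mathbf{i}=(i_1,\dots,i_\nu)$ in $I$ with $s_{i_1}s_{i_2}\cdots s_{i_\nu}=w_0$. For $i\in I$ define $i^!\in I$ by $s_iw_0=w_0s_{i^!}$. **The monoid $\mathfrak{U}(K)$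 and the set $\mathcal{U}(K)$.** $\mathfrak{U}(K)$ is the monoid with generators $\{i^a; i\in I,a\in K\}$ and relations: - $i^aj^b=j^bi^a$ if $i.j=0$, $a,b\in K$; - $i^aj^bi^c=j^{a'}i^{b'}j^{c'}$ if $i.j=-1$ and $a,b,c,a',b',c'\in K$ satisfy $ab=b'c'$, $a'b'=bc$, $b'=a+c$ (equivalently $b=a'+c'$); - $i^ai^b=i^{a+b}$ for $i\in I$, $a,b\in K$. For any $\mathbf{i}=(i_1,\dots,i_\nu)\in\mathcal{I}$ the map $f_{\mathbf{i}}:K^\nu\to\mathfrak{U}(K)$, $(a_1,\dots,a_\nu)\mapsto i_1^{a_1}i_2^{a_2}\cdots i_\nu^{a_\nu}$ is injective and its image, denoted $\mathcal{U}(K)$, does not depend on $\mathbf{i}$. **The maps $T_i(a)$.** For $i\in I$, $a\in K$ there is a well defined map $T_i(a):\mathcal{U}(K)\to\mathcal{U}(K)$ such that for every $\mathbf{i}=(i_1,\dots,i_\nu)\in\mathcal{I}$ with $i_1=i$ and every $(a_1,\dots,a_\nu)\in K^\nu$ one has $T_i(a)(f_{\mathbf{i}}(a_1,a_2,\dots,a_\nu))=f_{\mathbf{i}}(a_1a,a_2,\dots,a_\nu)$. **The involution $\phi_K$.** For $K=\mathbf{R}_{>0}$: let $G$ be the split simply connected semisimple group over $\mathbf{R}$ with Weyl group $W$, with a pinning given by opposite Borel subgroups $B^+,B^-$ and one-parameter root subgroups $x_i,y_i$ $(i\in I)$ in their unipotent radicals. Identify $\mathcal{U}(\mathbf{R}_{>0})$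 with a subset of the unipotent radical of $B^+$ by $i_1^{a_1}\cdots i_\nu^{a_\nu}\mapsto u=x_{i_1}(a_1)\cdots x_{i_\nu}(a_\nu)$, and with a subset of the unipotent radical of $B^-$ by $i_1^{a_1}\cdots i_\nu^{a_\nu}\mapsto u'=y_{i_1}(a_1)\cdots y_{i_\nu}(a_\nu)$. Then $\phi_{\mathbf{R}_{>0}}:\mathcal{U}(\mathbf{R}_{>0})\to\mathcal{U}(\mathbf{R}_{>0})$ sends the element corresponding to $u$ to the element corresponding to the unique $u'$ of this form such that $u^{-1}B^-u=u'^{-1}B^+u'$. In the coordinates $f_{\mathbf{i}}$ the map $\phi_{\mathbf{R}_{>0}}$ is given by subtraction-free rational functions; evaluating these in an arbitrary semifield $K$ gives a well defined involution $\phi_K:\mathcal{U}(K)\to\mathcal{U}(K)$, independent of $\mathbf{i}$. It satisfies $T_i(a)\phi_K=\phi_KT_{i^!}(a^{-1})$ for all $i\in I$, $a\in K$. **Flag manifold and half circles.** $\mathcal{B}_K=\{[H,H']\in\mathcal{U}(K)\times\mathcal{U}(K);\ \phi_K(H)=H'\}$. For $i\in I$ the multiplicative group of $K$ acts freely on $\mathcal{B}_K$ by $a:[H,H']\mapsto[T_i(a)H,T_{i^!}(a^{-1})H']$. The orbits of this action are called the half $i$-circles of $\mathcal{B}_K$. (The map $H\mapsto[H,\phi_K(H)]$ is a bijection $\mathcal{U}(K)\to\mathcal{B}_K$ under which the half $i$-circles correspond to the orbits of $a\mapsto T_i(a)$ on $\mathcal{U}(K)$.) **Distance.** For $k\in\mathbf{N}$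 and $B,B'\in\mathcal{B}_K$, one says that $B,B'$ are at distance $\le k$ if there is a sequence $B=B_1,B_2,\dots,B_{k+1}=B'$ in $\mathcal{B}_K$ such that for each $j\in\{1,\dots,k\}$ either $B_j=B_{j+1}$ or $B_j,B_{j+1}$ are joined by an edge. *)

(* Defs.v *)
From HB Require Import structures.
From mathcomp Require Import all_boot all_order all_algebra all_fingroup.
From mathcomp Require Import boolp classical_sets reals.

Set Implicit Arguments.
Unset Strict Implicit.
Unset Printing Implicit Defensive.

Import Order.TTheory GRing.Theory Num.Theory.

Local Open Scope classical_set_scope.
Local Open Scope ring_scope.

(** * Semifields *)

Record semifield : Type := Semifield {
  sf_car :> choiceType;
  sf_add : sf_car -> sf_car -> sf_car;
  sf_mul : sf_car -> sf_car -> sf_car;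
  sf_one : sf_car;
  sf_inv : sf_car -> sf_car;
  sf_addA : associative sf_add;
  sf_addC : commutative sf_add;
  sf_mulA : associative sf_mul;
  sf_mulC : commutative sf_mul;
  sf_mul1 : left_id sf_one sf_mul;
  sf_mulV : left_inverse sf_one sf_inv sf_mul;
  sf_mulDl : left_distributive sf_mul sf_add
}.

Arguments sf_one {s}.

Section PositiveSemifield.
Variable k : realFieldType.

Record pos : Type := Pos {pos_val : k; pos_valP : 0 < pos_val}.

HB.instance Definition _ := [isSub for pos_val].
HB.instance Definition _ := [Choice of pos by <:].

Definition pos_add (x y : pos) : pos := Pos (addr_gt0 (pos_valP x) (pos_valP y)).
Definition pos_mul (x y : pos) : pos := Pos (mulr_gt0 (pos_valP x) (pos_valP y)).
Definition pos_one : pos := Pos ltr01.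

Lemma posV_subproof (x : pos) : 0 < (pos_val x)^-1.
Proof. by rewrite invr_gt0 pos_valP. Qed.

Definition pos_inv (x : pos) : pos := Pos (posV_subproof x).

Lemma pos_addA : associative pos_add.
Proof. by move=> x y z; apply: val_inj; rewrite /= addrA. Qed.

Lemma pos_addC : commutative pos_add.
Proof. by move=> x y; apply: val_inj; rewrite /= addrC. Qed.

Lemma pos_mulA : associative pos_mul.
Proof. by move=> x y z; apply: val_inj; rewrite /= mulrA. Qed.

Lemma pos_mulC : commutative pos_mul.
Proof. by move=> x y; apply: val_inj; rewrite /= mulrC. Qed.

Lemma pos_mul1 : left_id pos_one pos_mul.
Proof. by move=> x; apply: val_inj; rewrite /= mul1r. Qed.

Lemma pos_mulV : left_inverse pos_one pos_inv pos_mul.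
Proof. by move=> x; apply: val_inj; rewrite /= mulVf // gt_eqF // pos_valP. Qed.

Lemma pos_mulDl : left_distributive pos_mul pos_add.
Proof. by move=> x y z; apply: val_inj; rewrite /= mulrDl. Qed.

Definition pos_semifield : semifield :=
  Semifield pos_addA pos_addC pos_mulA pos_mulC pos_mul1 pos_mulV pos_mulDl.

End PositiveSemifield.

(** * Simply laced finite Weyl groups *)

Section Weyl.
Variables (I : finType) (gT : finGroupType) (s : I -> gT).

(* [(gT, s)] is a Coxeter system: [gT] is generated by the involutions [s i]
   and presented by the relations [(s i * s j) ^+ m = 1], [m] being the order
   of [s i * s j]. *)
Definition coxeter_system : Prop :=
  [/\ forall i, #[s i]%g = 2%N,
      forall w : gT, exists r : seq I, w = (\prod_(i <- r) s i)%g
    & forall (H : groupType) (t : I -> H),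
        (forall i j, (t i * t j) ^+ #[s i * s j]%g = 1)%g ->
        exists phi : gT -> H,
          (forall v w, phi (v * w) = phi v * phi w)%g /\
          (forall i, phi (s i) = t i)].

(* A finite Coxeter group all of whose off-diagonal orders are 2 or 3 is
   crystallographic, so these are exactly the simply laced Weyl groups. *)
Definition simply_laced_weyl : Prop :=
  coxeter_system /\
  (forall i j, i != j -> #[s i * s j]%g = 2%N \/ #[s i * s j]%g = 3%N).

Definition dot (i j : I) : int :=
  if i == j then 2
  else if (s i * s j * s i == s j * s i * s j)%g then -1
  else 0.

(* The least [n] such that [w] is a product of [n] simple reflections; such an
   [n] is always smaller than the order of the group. *)
Definition coxlen (w : gT) : nat :=
  \big[minn/#|gT|]_(n < #|gT| | [exists r : n.-tuple I,
                                   (\prod_(i <- r) s i)%g == w]) (n : nat).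

Definition w0 : gT := [arg max_(w > 1%g) coxlen w]%N.

Definition nu : nat := coxlen w0.

Definition red_words : set (nu.-tuple I) :=
  [set i | (\prod_(l < nu) s (tnth i l))%g = w0].

(* The index [j] such that [s i * w0 = w0 * s j]. *)
Definition bang (i : I) : I :=
  odflt i [pick j | (s i * w0 == w0 * s j)%g].

End Weyl.

(** * The monoid attached to a semifield *)

Section Monoid.
Variables (I : finType) (gT : finGroupType) (s : I -> gT) (K : semifield).

Local Notation word := (seq (I * sf_car K)).

Inductive word_rel : word -> word -> Prop :=
| WordComm i j a b : dot s i j = 0 ->
    word_rel [:: (i, a); (j, b)] [:: (j, b); (i, a)]
| WordBraid i j a b c a' b' c' : dot s i j = -1 ->
    sf_mul a b = sf_mul b' c' -> sf_mul a' b' = sf_mul b c ->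
    b' = sf_add a c ->
    word_rel [:: (i, a); (j, b); (i, c)] [:: (j, a'); (i, b'); (j, c')]
| WordAdd i a b :
    word_rel [:: (i, a); (i, b)] [:: (i, sf_add a b)].

Inductive word_cong : word -> word -> Prop :=
| CongRel u v : word_rel u v -> word_cong u v
| CongRefl u : word_cong u u
| CongSym u v : word_cong u v -> word_cong v u
| CongTrans v u w : word_cong u v -> word_cong v w -> word_cong u w
| CongCat u u' v v' :
    word_cong u u' -> word_cong v v' -> word_cong (u ++ v) (u' ++ v').

Definition word_congb : rel word := fun u v => `[< word_cong u v >].

Lemma word_congb_refl : reflexive word_congb.
Proof. by move=> u; apply/asboolP; exact: CongRefl. Qed.

Lemma word_congb_sym : symmetric word_congb.
Proof. by move=> u v; apply/asboolP/asboolP => /CongSym. Qed.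

Lemma word_congb_trans : transitive word_congb.
Proof.
move=> v u w /asboolP uv /asboolP vw; apply/asboolP; exact: CongTrans uv vw.
Qed.

Canonical word_cong_equiv :=
  EquivRel word_congb word_congb_refl word_congb_sym word_congb_trans.

Definition fU : Type := {eq_quot word_congb}%qT.

HB.instance Definition _ := Choice.on fU.
HB.instance Definition _ := EqQuotient.on fU.

Definition fU_one : fU := \pi_fU%qT [::].
Definition fU_mul (x y : fU) : fU := \pi_fU%qT (generic_quotient.repr x ++ generic_quotient.repr y).
Definition fU_gen (i : I) (a : K) : fU := \pi_fU%qT [:: (i, a)].

Lemma fU_eqP (u v : word) :
  \pi_fU%qT u = \pi_fU%qT v <-> word_cong u v.
Proof.
split=> [/eqP | uv]; first by rewrite (@eqquotE _ word_congb fU) => /asboolP.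
by apply/eqP; rewrite (@eqquotE _ word_congb fU); apply/asboolP.
Qed.

Lemma fU_mulE (u v : word) :
  fU_mul (\pi_fU%qT u) (\pi_fU%qT v) = \pi_fU%qT (u ++ v).
Proof. by apply/fU_eqP; apply: CongCat; apply/fU_eqP; rewrite reprK. Qed.

Lemma fU_piP (x : fU) : exists u : word, x = \pi_fU%qT u.
Proof. by exists (generic_quotient.repr x); rewrite reprK. Qed.

Lemma fU_mulA : associative fU_mul.
Proof.
move=> x y z; have [u ->] := fU_piP x; have [v ->] := fU_piP y.
by have [w ->] := fU_piP z; rewrite !fU_mulE catA.
Qed.

Lemma fU_mul1 : left_id fU_one fU_mul.
Proof. by move=> x; have [u ->] := fU_piP x; rewrite fU_mulE. Qed.

Lemma fU_mulr1 : right_id fU_one fU_mul.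
Proof. by move=> x; have [u ->] := fU_piP x; rewrite fU_mulE cats0. Qed.

HB.instance Definition _ := isMonoid.Build fU fU_mulA fU_mul1 fU_mulr1.

Definition fcoord (i : (nu s).-tuple I) (a : 'I_(nu s) -> K) : fU :=
  (\prod_(l < nu s) fU_gen (tnth i l) (a l))%g.

Definition calU : set fU :=
  [set H | exists i, red_words i /\ exists a, H = fcoord i a].

(* Multiplication of the first coordinate by [c]. *)
Definition scale_first (n : nat) (c : K) (a : 'I_n -> K) : 'I_n -> K :=
  fun l => if l == 0%N :> nat then sf_mul (a l) c else a l.

(* The family of maps [T i c] on [calU]; only the values on [calU] matter, and
   these are determined by this property. *)
Definition is_T (T : I -> K -> fU -> fU) : Prop :=
  forall (j : I) (c : K) (i : (nu s).-tuple I) (a : 'I_(nu s) -> K),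
    red_words i -> ohead i = Some j ->
    T j c (fcoord i a) = fcoord i (scale_first c a).

End Monoid.

(** * Subtraction-free rational expressions *)

Inductive sfexpr (n : nat) : Type :=
| SfVar of 'I_n
| SfOne
| SfAdd of sfexpr n & sfexpr n
| SfMul of sfexpr n & sfexpr n
| SfInv of sfexpr n.

Arguments SfOne {n}.

Fixpoint sfeval (K : semifield) (n : nat) (a : 'I_n -> K) (e : sfexpr n) : K :=
  match e with
  | SfVar l => a l
  | SfOne => sf_one
  | SfAdd e1 e2 => sf_add (sfeval a e1) (sfeval a e2)
  | SfMul e1 e2 => sf_mul (sfeval a e1) (sfeval a e2)
  | SfInv e1 => sf_inv (sfeval a e1)
  end.

(** * Pinned split simply connected groups *)

Section Group.
Variable G : groupType.

Definition is_subgroup (H : set G) : Prop :=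
  [/\ H 1%g, (forall g h, H g -> H h -> H (g * h)%g)
    & (forall g, H g -> H g^-1%g)].

Definition subgroup_gen (S : set G) : set G := smallest is_subgroup S.

Definition conj_set (u : G) (B : set G) : set G :=
  [set (u^-1 * b * u)%g | b in B].

Definition double_coset (B : set G) (g : G) : set G :=
  [set h | exists b b', [/\ B b, B b' & h = (b * g * b')%g]].

Variables (F : fieldType) (I : finType) (x y : I -> F -> G).

(* In SL_2 these are [[0, t], [-1/t, 0]] and diag(t, 1/t). *)
Definition pin_n (i : I) (t : F) : G := (x i t * y i (- t^-1) * x i t)%g.
Definition pin_h (i : I) (t : F) : G := (pin_n i t * (pin_n i 1)^-1)%g.

Definition torus : set G :=
  subgroup_gen [set g | exists i t, t != 0 /\ g = pin_h i t].

Definition unip (z : I -> F -> G) : set G :=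
  subgroup_gen [set g | exists i a, g = z i a].

Definition borel (z : I -> F -> G) : set G :=
  subgroup_gen (torus `|` unip z).

Definition torus_normalizer : set G :=
  subgroup_gen (torus `|` [set g | exists i, g = pin_n i 1]).

End Group.

(* The group [G(F)] of [F]-points of the split simply connected semisimple
   group with Weyl group [(gT, s)], and a pinning: [x i] and [y i] are the root
   subgroups of the simple roots and of their opposites, [torus] is the
   intersection of the Borel subgroups [borel x] and [borel y], and the
   quotient of [torus_normalizer] by [torus] is the Weyl group. The fields are
   the Chevalley-Steinberg relations, the freeness of the torus on the simple
   coroots (simple connectedness), and the structure theorems on the relative
   position of the Borel subgroups and the torus normalizer (BN-pair); the
   relations together with the freeness of the torus determine the group up to
   isomorphism. In [pg_w0], a representative of the longest element carries the
   root of [bang s i] to the opposite of the root of [i]. *)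
Record pinned_group (F : fieldType) (I : finType) (gT : finGroupType)
    (s : I -> gT) : Type := PinnedGroup {
  pg_car :> groupType;
  pg_x : I -> F -> pg_car;
  pg_y : I -> F -> pg_car;
  pg_gen : forall g, subgroup_gen
    ([set h | exists i a, h = pg_x i a] `|` [set h | exists i a, h = pg_y i a])
    g;
  pg_xD : forall i a b, pg_x i (a + b) = (pg_x i a * pg_x i b)%g;
  pg_yD : forall i a b, pg_y i (a + b) = (pg_y i a * pg_y i b)%g;
  pg_xy : forall i j a b, i != j -> commute (pg_x i a) (pg_y j b);
  pg_xC : forall i j a b, dot s i j = 0 -> commute (pg_x i a) (pg_x j b);
  pg_yC : forall i j a b, dot s i j = 0 -> commute (pg_y i a) (pg_y j b);
  pg_x_braid : forall i j a b c a' b' c', dot s i j = -1 ->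
    a * b = b' * c' -> a' * b' = b * c -> b' = a + c -> b = a' + c' ->
    (pg_x i a * pg_x j b * pg_x i c = pg_x j a' * pg_x i b' * pg_x j c')%g;
  pg_y_braid : forall i j a b c a' b' c', dot s i j = -1 ->
    a * b = b' * c' -> a' * b' = b * c -> b' = a + c -> b = a' + c' ->
    (pg_y i a * pg_y j b * pg_y i c = pg_y j a' * pg_y i b' * pg_y j c')%g;
  pg_n_x : forall i t a, t != 0 ->
    (pin_n pg_x pg_y i t * pg_x i a * (pin_n pg_x pg_y i t)^-1)%g
      = pg_y i (- (t ^- 2 * a));
  pg_hM : forall i t u, t != 0 -> u != 0 ->
    pin_h pg_x pg_y i (t * u) = (pin_h pg_x pg_y i t * pin_h pg_x pg_y i u)%g;
  pg_h_x : forall i j t a, t != 0 ->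
    (pin_h pg_x pg_y i t * pg_x j a * (pin_h pg_x pg_y i t)^-1)%g
      = pg_x j (t ^ dot s i j * a);
  pg_h_y : forall i j t a, t != 0 ->
    (pin_h pg_x pg_y i t * pg_y j a * (pin_h pg_x pg_y i t)^-1)%g
      = pg_y j (t ^ (- dot s i j) * a);
  pg_torus_free : forall t u : I -> F,
    (forall i, t i != 0) -> (forall i, u i != 0) ->
    (\prod_i pin_h pg_x pg_y i (t i))%g = (\prod_i pin_h pg_x pg_y i (u i))%g ->
    forall i, t i = u i;
  pg_opp_x : borel pg_x pg_y pg_y `&` unip pg_x = [set 1%g];
  pg_opp_y : borel pg_x pg_y pg_x `&` unip pg_y = [set 1%g];
  pg_weyl : pg_car -> gT;
  pg_weylM : forall n n', torus_normalizer pg_x pg_y n ->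
    torus_normalizer pg_x pg_y n' ->
    pg_weyl (n * n')%g = (pg_weyl n * pg_weyl n')%g;
  pg_weyl_n : forall i, pg_weyl (pin_n pg_x pg_y i 1) = s i;
  pg_weyl_ker : forall n, torus_normalizer pg_x pg_y n ->
    (pg_weyl n = 1%g <-> torus pg_x pg_y n);
  pg_BN : borel pg_x pg_y pg_x `&` torus_normalizer pg_x pg_y
          = torus pg_x pg_y;
  pg_tits : forall i n b, torus_normalizer pg_x pg_y n ->
    borel pg_x pg_y pg_x b ->
    (double_coset (borel pg_x pg_y pg_x) n `|`
     double_coset (borel pg_x pg_y pg_x) (pin_n pg_x pg_y i 1 * n)%g)
      (pin_n pg_x pg_y i 1 * b * n)%g;
  pg_w0 : forall n i, torus_normalizer pg_x pg_y n -> pg_weyl n = w0 s ->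
    exists2 c : F, c != 0 &
      forall a, (n * pg_x (bang s i) a * n^-1)%g = pg_y i (c * a)
}.

Section Involution.
Variables (I : finType) (gT : finGroupType) (s : I -> gT).
Variables (Re : realType) (G : pinned_group Re s).

Definition Bplus : set G := borel (@pg_x _ _ _ _ G) (@pg_y _ _ _ _ G)
                                  (@pg_x _ _ _ _ G).
Definition Bminus : set G := borel (@pg_x _ _ _ _ G) (@pg_y _ _ _ _ G)
                                   (@pg_y _ _ _ _ G).

Definition xcoord (i : (nu s).-tuple I) (a : 'I_(nu s) -> pos Re) : G :=
  (\prod_(l < nu s) pg_x G (tnth i l) (pos_val (a l)))%g.

Definition ycoord (i : (nu s).-tuple I) (a : 'I_(nu s) -> pos Re) : G :=
  (\prod_(l < nu s) pg_y G (tnth i l) (pos_val (a l)))%g.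

(* The subtraction-free tuple [P] expresses, in the coordinates [fcoord i],
   the involution over the positive reals. *)
Definition real_phi_coords (i : (nu s).-tuple I)
    (P : 'I_(nu s) -> sfexpr (nu s)) : Prop :=
  forall a : 'I_(nu s) -> pos_semifield Re,
    conj_set (xcoord i a) Bminus
    = conj_set (ycoord i (fun l => sfeval a (P l))) Bplus.

(* The map obtained over [K] by evaluating such tuples; again only the values
   on [calU] matter, and these are determined by this property. *)
Definition is_phi (K : semifield) (phi : fU s K -> fU s K) : Prop :=
  forall i : (nu s).-tuple I, red_words i ->
    exists P : 'I_(nu s) -> sfexpr (nu s),
      real_phi_coords i P /\
      forall a : 'I_(nu s) -> K,
        phi (fcoord i a) = fcoord i (fun l => sfeval a (P l)).

End Involution.

(** * The flag manifold and its graph *)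

Section FlagManifold.
Variables (I : finType) (gT : finGroupType) (s : I -> gT) (K : semifield).
Variables (T : I -> K -> fU s K -> fU s K) (phi : fU s K -> fU s K).

Definition flag_manifold : set (fU s K * fU s K) :=
  [set B | [/\ calU B.1, calU B.2 & phi B.1 = B.2]].

Definition flag_act (i : I) (a : K) (B : fU s K * fU s K) :
    fU s K * fU s K :=
  (T i a B.1, T (bang s i) (sf_inv a) B.2).

Definition half_circle (i : I) (C : set (fU s K * fU s K)) : Prop :=
  exists2 B, flag_manifold B & C = [set flag_act i a B | a in [set: K]].

Definition flag_edge (B B' : fU s K * fU s K) : Prop :=
  B <> B' /\ exists i C, [/\ half_circle i C, C B & C B'].

End FlagManifold.

Definition dist_le (X : Type) (V : set X) (E : X -> X -> Prop) (k : nat)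
    (B B' : X) : Prop :=
  exists p : nat -> X,
    [/\ p 0%N = B, p k = B', forall j, (j <= k)%N -> V (p j)
      & forall j, (j < k)%N -> p j = p j.+1 \/ E (p j) (p j.+1)].

Definition graph_connected (X : Type) (V : set X) (E : X -> X -> Prop) : Prop :=
  forall B B', V B -> V B' ->
    exists k, exists p : nat -> X,
      [/\ p 0%N = B, p k = B', forall j, (j <= k)%N -> V (p j)
        & forall j, (j < k)%N -> E (p j) (p j.+1)].

(* Main.v *)
Require Import Defs.
From mathcomp Require Import all_boot all_order all_algebra all_fingroup.
From mathcomp Require Import boolp classical_sets reals.
From mathcomp Require Import zify ring lra.

(* Moving a point of [calU] along half circles amounts, in the monoid, to
   multiplying it on the left by generators (a generator changes the first
   coordinate only). Two elements [H] and [H'] are joined through a common left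
   multiple [W H = W' H'], where [W] and [W'] have coordinates along the same
   reduced word: this takes [nu] steps on each side, and the two steps given by
   the first letter lie on one half circle, which leaves [2 nu - 1].
   For the common multiple, take [W] with all coordinates equal to a large
   [L]. Changes of reduced words are homogeneous and subtraction-free, so the
   coordinates of [W H] stay between positive multiples of [L] along every
   reduced word; hence the letters of [H'] can be subtracted on the right one
   after the other.
   That half circles on the two components of a flag correspond to each other
   is proved in the real group: the flags of a half circle lie on a projective
   line, its two parametrizations are related by a Moebius transformation, and
   the Bruhat decomposition shows that this transformation exchanges [0] and
   infinity, i.e. is [t |-> b a / t]. The resulting identity between
   subtraction-free expressions then holds over any ordered field. The
   Coxeter-theoretic facts (exchange condition, Matsumoto's theorem, the longest
   element) are also read off the Bruhat decomposition. *)

Set Implicit Arguments.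
Unset Strict Implicit.
Unset Printing Implicit Defensive.

Import Order.TTheory GRing.Theory Num.Theory.

(** * Lengths in a Coxeter system *)

Section CoxeterWords.
Local Open Scope group_scope.
Variables (I : finType) (gT : finGroupType) (s : I -> gT).

Definition wprod (r : seq I) : gT := \prod_(i <- r) s i.

Lemma wprod_nil : wprod [::] = 1.
Proof. by rewrite /wprod big_nil. Qed.

Lemma wprod_cons i r : wprod (i :: r) = s i * wprod r.
Proof. by rewrite /wprod big_cons. Qed.

Lemma wprod_cat r r' : wprod (r ++ r') = wprod r * wprod r'.
Proof. by rewrite /wprod big_cat. Qed.

Lemma wprod_rcons r i : wprod (rcons r i) = wprod r * s i.
Proof. by rewrite -cats1 wprod_cat wprod_cons wprod_nil mulg1. Qed.

Lemma bigmin_le (J : finType) (P : pred J) (F : J -> nat) (x : nat) :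
  (\big[minn/x]_(j | P j) F j <= x)%N /\
  (forall j, P j -> \big[minn/x]_(j | P j) F j <= F j)%N.
Proof.
split; first by elim/big_rec: _ => // j y _ yx; rewrite geq_min yx orbT.
move=> j; move: (mem_index_enum j); elim: (index_enum J) => // k r IH.
rewrite inE big_cons => /orP [/eqP <- -> | jr Pj]; first by rewrite geq_minl.
by case: ifP => _; rewrite ?geq_min ?IH ?orbT.
Qed.

Lemma bigmin_mem (J : finType) (P : pred J) (F : J -> nat) (x : nat) :
  \big[minn/x]_(j | P j) F j = x \/
  exists2 j, P j & \big[minn/x]_(j | P j) F j = F j.
Proof.
elim/big_rec: _ => [|j y Pj [->|[k Pk ->]]]; first by left.
- by case: (leqP (F j) x) => _; [right; exists j | left].
- by right; case: (leqP (F j) (F k)) => _; [exists j | exists k].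
Qed.

Lemma coxlen_le r : (coxlen s (wprod r) <= size r)%N.
Proof.
case: (ltnP (size r) #|gT|) => [r_lt | le_r]; last first.
  exact: leq_trans (proj1 (bigmin_le _ _ _)) le_r.
have [_ /(_ (Ordinal r_lt))] := bigmin_le
  (fun n : 'I_#|gT| => [exists r' : n.-tuple I, \prod_(i <- r') s i == wprod r])
  (fun n : 'I_#|gT| => n : nat) #|gT|.
by apply; apply/existsP; exists (in_tuple r).
Qed.

(** Pigeonhole: there are more than [#|gT|] prefixes, so two of them have the same product and the
    letters between them can be cut out. *)
Lemma shorten_word r : (#|gT| <= size r)%N ->
  exists2 r', wprod r' = wprod r & (size r' < size r)%N.
Proof.
move=> le_r.
have /injectivePn [a [b neq_ab eq_ab]] :
    ~~ injectiveb (fun l : 'I_(size r).+1 => wprod (take l r)).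
  apply/negP => /injectiveP /leq_card; rewrite card_ord => lt_r.
  by have := leq_trans lt_r le_r; rewrite ltnn.
wlog lt_ab : a b neq_ab eq_ab / (a < b)%N => [wlg|].
  case: (ltngtP a b) => [|/wlg|/val_inj/eqP]; first exact: wlg.
    by rewrite eq_sym neq_ab => /(_ isT (esym eq_ab)).
  by rewrite (negPf neq_ab).
exists (take a r ++ drop b r).
  by rewrite wprod_cat eq_ab -wprod_cat cat_take_drop.
rewrite size_cat size_take_min size_drop; have := ltn_ord b; lia.
Qed.

(** By [shorten_word] a shortest word has at most [#|gT|] letters, so the default value of the
    minimum in [coxlen] does no harm. *)
Lemma coxlen_word r0 : exists2 r, wprod r = wprod r0 &
  size r = coxlen s (wprod r0).
Proof.
have: exists r, wprod r = wprod r0 /\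
    forall r', wprod r' = wprod r0 -> (size r <= size r')%N.
  have ex : exists n, `[< exists2 r, wprod r = wprod r0 & size r = n >].
    by exists (size r0); apply/asboolP; exists r0.
  have [n /asboolP [r rE <-] min_n] := ex_minnP ex; exists r; split=> // r' r'E.
  by apply: min_n; apply/asboolP; exists r'.
move=> [r [rE min_r]]; exists r => //; apply/eqP;
  rewrite eqn_leq -{2}rE coxlen_le.
rewrite andbT; have [E|[n]] := bigmin_mem
  (fun n : 'I_#|gT| => [exists r' : n.-tuple I,
    \prod_(i <- r') s i == wprod r0])
  (fun n : 'I_#|gT| => n : nat) #|gT|.
  rewrite /coxlen E; case: (leqP (size r) #|gT|) => // /ltnW /shorten_word.
  by case=> r' r'E; rewrite ltnNge min_r // r'E.
move=> /existsP [r' /eqP r'E]; rewrite -/(coxlen _ _) => ->.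
by rewrite -(size_tuple r'); apply: min_r.
Qed.

Definition reduced (r : seq I) : Prop := size r = coxlen s (wprod r).

Hypothesis cox : coxeter_system s.

Lemma word_of (w : gT) : exists r, wprod r = w.
Proof. by have [_ /(_ w) [r ->] _] := cox; exists r. Qed.

Lemma reduced_word (w : gT) : exists2 r, wprod r = w & size r = coxlen s w.
Proof. by have [r <-] := word_of w; apply: coxlen_word. Qed.

Lemma s_sqr i : s i * s i = 1.
Proof. by have [/(_ i) o2 _ _] := cox; have := expg_order (s i);
  rewrite o2. Qed.

Lemma s_inv i : (s i)^-1 = s i.
Proof. by apply/eqP; rewrite eq_invg_mul s_sqr. Qed.

Lemma wprod_rev r : wprod (rev r) = (wprod r)^-1.
Proof.
elim: r => [|i r IH]; first by rewrite /= wprod_nil invg1.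
by rewrite rev_cons wprod_rcons IH wprod_cons invMg s_inv.
Qed.

Lemma coxlenV w : coxlen s w^-1 = coxlen s w.
Proof.
have le v : (coxlen s v^-1 <= coxlen s v)%N.
  by have [r rE <-] := reduced_word v;
    rewrite -rE -wprod_rev -(size_rev r) coxlen_le.
by apply/eqP; rewrite eqn_leq le -{1}[w]invgK le.
Qed.

Lemma coxlen1 : coxlen s 1 = 0%N.
Proof. by have := coxlen_le [::]; rewrite wprod_nil /=; lia. Qed.

Lemma coxlen_eq0 w : coxlen s w = 0%N -> w = 1.
Proof. by have [r <- <-] := reduced_word w => /size0nil ->;
  rewrite wprod_nil. Qed.

Lemma coxlen_s i : (coxlen s (s i) <= 1)%N.
Proof. by have := coxlen_le [:: i]; rewrite wprod_cons wprod_nil mulg1. Qed.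

Lemma coxlenM v w : (coxlen s (v * w) <= coxlen s v + coxlen s w)%N.
Proof.
have [r <- <-] := reduced_word v; have [r' <- <-] := reduced_word w.
by rewrite -wprod_cat -size_cat coxlen_le.
Qed.

(* The sign character, which exists because the group is presented by the
   Coxeter relations, shows that the length changes parity. *)
Lemma coxlen_sM_neq i w : coxlen s (s i * w) <> coxlen s w.
Proof.
pose t := tperm true false.
have t2 : t * t = 1 by apply: tperm2.
have [_ _ /(_ {perm bool} (fun _ => t)) [|f [fM fs]]] := cox.
  by move=> j k; rewrite t2 expg1n.
have f1 : f 1 = 1 by apply: (mulgI (f 1)); rewrite -fM !mulg1.
have fw r : f (wprod r) = t ^+ size r.
  elim: r => [|j r IH]; first by rewrite wprod_nil f1.
  by rewrite wprod_cons fM fs IH expgS.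
have fl v : f v = t ^+ coxlen s v.
  by have [r <- <-] := reduced_word v; rewrite fw.
move=> E; have := fl (s i * w); rewrite fM fs E -fl => /(canRL (mulgK _)).
by rewrite mulgV => /permP /(_ true); rewrite tpermL perm1.
Qed.

Lemma coxlen_sM i w : coxlen s (s i * w) = (coxlen s w).+1 \/
  coxlen s w = (coxlen s (s i * w)).+1.
Proof.
have := coxlenM (s i) w; have := coxlenM (s i) (s i * w).
rewrite mulgA s_sqr mul1g; have := @coxlen_sM_neq i w; have := coxlen_s i.
lia.
Qed.

Lemma coxlen_Ms i w : coxlen s (w * s i) = (coxlen s w).+1 \/
  coxlen s w = (coxlen s (w * s i)).+1.
Proof.
rewrite -coxlenV -(coxlenV w) invMg s_inv; exact: coxlen_sM.
Qed.

Lemma reduced_catl p q : reduced (p ++ q) -> reduced p.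
Proof.
rewrite /reduced wprod_cat size_cat => E.
have := coxlenM (wprod p) (wprod q); have := coxlen_le p; have := coxlen_le q.
lia.
Qed.

Lemma reduced_catr p q : reduced (p ++ q) -> reduced q.
Proof.
rewrite /reduced wprod_cat size_cat => E.
have := coxlenM (wprod p) (wprod q); have := coxlen_le p; have := coxlen_le q.
lia.
Qed.

Lemma reduced_cons i r : reduced (i :: r) ->
  reduced r /\ coxlen s (s i * wprod r) = (coxlen s (wprod r)).+1.
Proof.
move=> red; have red_r := @reduced_catr [:: i] r red; split=> //.
by rewrite -red_r -wprod_cons -red.
Qed.

End CoxeterWords.

(** * Bruhat cells *)

Section GeneratedSubgroup.
Local Open Scope group_scope.
Variable H : groupType.
Implicit Types S A : set H.

Lemma gen_sub S g : S g -> subgroup_gen S g.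
Proof. exact: sub_gen_smallest. Qed.

Lemma gen_min A S g : is_subgroup A -> (S `<=` A)%classic ->
  subgroup_gen S g -> A g.
Proof. by move=> sgA SA; apply: smallest_sub. Qed.

Lemma gen_subgroup S : is_subgroup (subgroup_gen S).
Proof.
split=> [A [[A1 _ _] _] // | g h Sg Sh A AP | g Sg A AP].
  by have [[_ AM _] _] := AP; apply: AM; [apply: Sg | apply: Sh].
by have [[_ _ AV] _] := AP; apply: AV; apply: Sg.
Qed.

Lemma gen_1 S : subgroup_gen S 1.
Proof. by have [] := gen_subgroup S. Qed.

Lemma gen_M S g h : subgroup_gen S g -> subgroup_gen S h ->
  subgroup_gen S (g * h).
Proof. by have [_ genM _] := gen_subgroup S; apply: genM. Qed.

Lemma gen_V S g : subgroup_gen S g -> subgroup_gen S g^-1.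
Proof. by have [_ _] := gen_subgroup S; apply. Qed.

End GeneratedSubgroup.

Section BNPair.
Local Open Scope group_scope.
Variables (F : realFieldType) (I : finType) (gT : finGroupType) (s : I -> gT).
Variable G : pinned_group F s.
Hypothesis cox : coxeter_system s.

Local Notation x := (@pg_x _ _ _ _ G).
Local Notation y := (@pg_y _ _ _ _ G).
Local Notation n_ := (pin_n x y).
Local Notation h_ := (pin_h x y).
Local Notation T := (torus x y).
Local Notation N := (torus_normalizer x y).
Local Notation B := (borel x y x).
Local Notation weyl := (@pg_weyl _ _ _ _ G).
Local Notation len := (coxlen s).

Lemma pg_x0 i : x i 0%R = 1.
Proof. by apply: (mulgI (x i 0%R)); rewrite -pg_xD addr0 mulg1. Qed.

Lemma pg_y0 i : y i 0%R = 1.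
Proof. by apply: (mulgI (y i 0%R)); rewrite -pg_yD addr0 mulg1. Qed.

Lemma pg_xN i a : x i (- a)%R = (x i a)^-1.
Proof. by apply: (mulgI (x i a)); rewrite -pg_xD addrN mulgV pg_x0. Qed.

Lemma pg_yN i a : y i (- a)%R = (y i a)^-1.
Proof. by apply: (mulgI (y i a)); rewrite -pg_yD addrN mulgV pg_y0. Qed.

Lemma pin_nN i t : n_ i (- t)%R = (n_ i t)^-1.
Proof. by rewrite /pin_n invrN opprK !invMg -!pg_xN -pg_yN opprK mulgA. Qed.

Lemma torus_h i t : t != 0%R -> T (h_ i t).
Proof. by move=> t0; apply: gen_sub; exists i, t. Qed.

Lemma torus_N g : T g -> N g.
Proof. by move=> Tg; apply: gen_sub; left. Qed.

Lemma torus_B g : T g -> B g.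
Proof. by move=> Tg; apply: gen_sub; left. Qed.

Lemma x_B i a : B (x i a).
Proof. by apply: gen_sub; right; apply: gen_sub; exists i, a. Qed.

Lemma pin_hE i t : n_ i t = h_ i t * n_ i 1%R.
Proof. by rewrite /pin_h mulgVK. Qed.

Lemma pin_n_N i t : t != 0%R -> N (n_ i t).
Proof.
move=> t0; rewrite pin_hE; apply: gen_M; first by apply: torus_N;
  apply: torus_h.
by apply: gen_sub; right; exists i.
Qed.

Lemma pin_nn_torus i t u : t != 0%R -> u != 0%R -> T (n_ i t * n_ i u).
Proof.
move=> t0 u0; rewrite -[u]opprK pin_nN (pin_hE i t) (pin_hE i (- u)%R) invMg
  mulgA mulgK.
by apply: gen_M; [|apply: gen_V]; apply: torus_h; rewrite ?oppr_eq0.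
Qed.

Lemma weyl1 : weyl 1 = 1.
Proof.
have N1 : N 1 by apply: gen_1.
by apply: (mulgI (weyl 1)); rewrite -pg_weylM // !mulg1.
Qed.

Lemma weylV n : N n -> weyl n^-1 = (weyl n)^-1.
Proof.
move=> Nn; apply: (mulgI (weyl n)); rewrite -pg_weylM ?mulgV ?weyl1 //.
exact: gen_V.
Qed.

Lemma weyl_pin_n i t : t != 0%R -> weyl (n_ i t) = s i.
Proof.
move=> t0; have Nn : N (n_ i 1%R) by apply: pin_n_N; rewrite oner_eq0.
have Th := torus_h i t0.
rewrite pin_hE pg_weylM //; last exact: torus_N.
rewrite pg_weyl_n (_ : weyl _ = 1) ?mul1g //.
by apply/pg_weyl_ker => //; apply: torus_N.
Qed.

Lemma weyl_onto w : exists2 n, N n & weyl n = w.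
Proof.
have [r <-] := word_of cox w; elim: r => [|i r [n Nn nE]].
  by exists 1; [apply: gen_1 | rewrite weyl1 wprod_nil].
have Ni : N (n_ i 1%R) by apply: pin_n_N; rewrite oner_eq0.
exists (n_ i 1%R * n); first exact: gen_M.
by rewrite pg_weylM // nE pg_weyl_n wprod_cons.
Qed.

(** The product defining [pin_n] at [- a^-1] has [y i a] as its middle factor; solving for it is
    what puts [y i a] in the cell of [s i]. *)
Lemma y_pin_n i a : a != 0%R ->
  y i a = x i a^-1%R * n_ i (- a^-1)%R * x i a^-1%R.
Proof.
move=> a0; rewrite /pin_n invrN invrK opprK pg_xN !mulgA mulgV mul1g.
by rewrite mulgVK.
Qed.

(** The Bruhat cell B w B. The representative of [w] is bound inside, no section of [pg_weyl] being
    given; by [cell_rep] any representative serves. *)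
Definition cell (w : gT) (g : G) : Prop :=
  exists n, [/\ N n, weyl n = w & double_coset B n g].

Lemma cell_rep n w g : N n -> weyl n = w -> cell w g ->
  exists b b', [/\ B b, B b' & g = b * n * b'].
Proof.
move=> Nn nE [n' [Nn' n'E [b [b' [Bb Bb' ->]]]]].
have Tn : T (n' * n^-1).
  have NV : N n^-1 by apply: gen_V.
  apply/pg_weyl_ker; first exact: gen_M.
  by rewrite pg_weylM // weylV // nE n'E mulgV.
exists (b * (n' * n^-1)), b'; split=> //.
  by apply: gen_M => //; apply: torus_B.
by rewrite !mulgA mulgVK.
Qed.

Lemma cell_N n : N n -> cell (weyl n) n.
Proof.
move=> Nn; exists n; split=> //; exists 1, 1; split; try exact: gen_1.
by rewrite mul1g mulg1.
Qed.

Lemma cell_lmul b w g : B b -> cell w g -> cell w (b * g).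
Proof.
move=> Bb [n [Nn nE [b1 [b2 [Bb1 Bb2 ->]]]]]; exists n; split=> //.
by exists (b * b1), b2; split=> //; [apply: gen_M | rewrite !mulgA].
Qed.

Lemma cell_rmul b w g : B b -> cell w g -> cell w (g * b).
Proof.
move=> Bb [n [Nn nE [b1 [b2 [Bb1 Bb2 ->]]]]]; exists n; split=> //.
by exists b1, (b2 * b); split=> //; [apply: gen_M | rewrite !mulgA].
Qed.

Lemma cellV w g : cell w g -> cell w^-1 g^-1.
Proof.
move=> [n [Nn nE [b1 [b2 [Bb1 Bb2 ->]]]]]; exists n^-1; split.
- exact: gen_V.
- by rewrite weylV // nE.
by exists b2^-1, b1^-1; split; try exact: gen_V; rewrite !invMg mulgA.
Qed.

Lemma cell1 g : cell 1 g <-> B g.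
Proof.
have N1 : N 1 by apply: gen_1.
split=> [/(cell_rep N1 weyl1) [b [b' [Bb Bb' ->]]] | Bg].
  by rewrite mulg1; apply: gen_M.
by rewrite -[g]mulg1; apply: cell_lmul => //; rewrite -weyl1; apply: cell_N.
Qed.

Lemma cell_sM i w g h : cell (s i) g -> cell w h ->
  cell w (g * h) \/ cell (s i * w) (g * h).
Proof.
have Ni : N (n_ i 1%R) by apply: pin_n_N; rewrite oner_eq0.
move=> /(cell_rep Ni (pg_weyl_n _ _)) [b1 [b2 [Bb1 Bb2 ->]]].
move=> [n [Nn nE [b3 [b4 [Bb3 Bb4 ->]]]]].
rewrite (_ : _ * _ = b1 * (n_ i 1%R * (b2 * b3) * n) * b4); last first.
  by rewrite !mulgA.
case: (@pg_tits _ _ _ _ G i n (b2 * b3)) => //; first exact: gen_M.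
- move=> dc; left; apply: cell_rmul => //; apply: cell_lmul => //.
  by exists n.
- move=> dc; right; apply: cell_rmul => //; apply: cell_lmul => //.
  exists (n_ i 1%R * n); split=> //; first exact: gen_M.
  by rewrite pg_weylM // pg_weyl_n nE.
Qed.

Lemma cell_Ms i w g h : cell w g -> cell (s i) h ->
  cell w (g * h) \/ cell (w * s i) (g * h).
Proof.
move=> /cellV Cg /cellV; rewrite (s_inv cox) => Ch.
have := cell_sM Ch Cg; rewrite -invMg => -[] /cellV; rewrite invgK.
  by rewrite invgK; left.
by rewrite invMg invgK (s_inv cox); right.
Qed.

(** Induction on the smaller length. With w = s_i v, moving s_i to the other side gives an element
    of the cell of v lying in the cell of w' or of s_i w'. By induction v = w', which contradicts
    the lengths, or v = s_i w', which is the claim. *)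
Lemma cell_disjoint w w' g : cell w g -> cell w' g -> w = w'.
Proof.
wlog: w w' / (len w <= len w')%N => [wlg Cw Cw'|].
  case: (leqP (len w) (len w')) => [/wlg|/ltnW/wlg]; first exact.
  by move/(_ Cw' Cw).
have [m] := ubnP (len w); elim: m => // m IH in w w' g *.
rewrite ltnS => le_m le_w Cw Cw'.
have [[|i r] rE size_r] := reduced_word cox w.
  move: Cw; rewrite -rE wprod_nil => /cell1 Bg.
  have [n [Nn <- [b [b' [Bb Bb' gE]]]]] := Cw'.
  have Tn : T n.
    have nE : n = b^-1 * g * b'^-1 by rewrite gE !mulgA mulVg mul1g mulgK.
    have Bn : B n.
      by rewrite nE; apply: gen_M; [apply: gen_M => // | ]; apply: gen_V.
    by have := pg_BN G; move/seteqP => [/(_ n) sub _]; apply: sub.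
  by symmetry; apply/pg_weyl_ker.
move: rE; rewrite wprod_cons; set v := wprod s r => rE.
have len_v : (len v < len w)%N.
  by have := coxlen_le s r; rewrite -size_r -/v.
have [nv Nv nvE] := weyl_onto v.
have [ni Ni niE] := weyl_onto (s i).
have Nw : N (ni * nv) by apply: gen_M.
have nwE : weyl (ni * nv) = w by rewrite pg_weylM // niE nvE.
have [b [b' [Bb Bb' gE]]] := cell_rep Nw nwE Cw.
have Ch : cell v (nv * b') by apply: cell_rmul => //; rewrite -nvE;
  apply: cell_N.
have hE : nv * b' = ni^-1 * (b^-1 * g).
  by rewrite gE !mulgA mulgVK mulVg mul1g.
have CnV : cell (s i) ni^-1.
  by rewrite -(s_inv cox i) -niE; apply/cellV/cell_N.
have lt_v := leq_trans len_v le_m.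
have /(cell_sM CnV) : cell w' (b^-1 * g) by apply: cell_lmul => //;
  apply: gen_V.
rewrite -hE => -[Ch'|Ch'].
  have le_vw' := leq_trans (ltnW len_v) le_w.
  have vw' := IH _ _ _ lt_v le_vw' Ch Ch'.
  by move: le_w; rewrite -vw' leqNgt len_v.
have le_v : (len v <= len (s i * w'))%N.
  by have := coxlen_sM cox i w'; lia.
by rewrite -rE (IH _ _ _ lt_v le_v Ch Ch') mulgA (s_sqr cox) mul1g.
Qed.

(** Induction on the length, with w = v s_t reduced. If the product stayed in the cell of w,
    removing s_t on the right would leave an element in the cell of w or of v, whereas by induction
    it lies in that of s_i v. Lengths exclude both equalities. *)
Lemma cell_longer i w g h : len (s i * w) = (len w).+1 ->
  cell (s i) g -> cell w h -> cell (s i * w) (g * h).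
Proof.
have [m] := ubnP (len w); elim: m => // m IH in w g h *.
rewrite ltnS => le_m longer Cg Ch.
have [r rE size_r] := reduced_word cox w; case/lastP: r rE size_r => [|r t].
  rewrite wprod_nil => w1 _; move: Ch; rewrite -w1 => /cell1 Bh.
  by rewrite mulg1; apply: cell_rmul.
rewrite wprod_rcons size_rcons; set v := wprod s r => rE size_r.
have len_v : (len v <= size r)%N := coxlen_le s r.
move: v rE len_v => v rE len_v.
case: (cell_sM Cg Ch) => // Cgh; exfalso.
have [nv Nv nvE] := weyl_onto v.
have [nt Nt ntE] := weyl_onto (s t).
have Nw : N (nv * nt) by apply: gen_M.
have nwE : weyl (nv * nt) = w by rewrite pg_weylM // ntE nvE.
have [b [b' [Bb Bb' hE]]] := cell_rep Nw nwE Ch.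
have Cv : cell v (b * nv) by apply: cell_lmul => //; rewrite -nvE;
  apply: cell_N.
have kE : g * (b * nv) = g * h * b'^-1 * nt^-1.
  by rewrite hE !mulgA !mulgK.
have CnV : cell (s t) nt^-1.
  by rewrite -(s_inv cox t) -ntE; apply/cellV/cell_N.
have longer_v : len (s i * v) = (len v).+1.
  have := coxlen_sM cox i v; have := coxlenM cox (s i * v) (s t).
  by have := coxlen_s s t; rewrite -mulgA rE longer -size_r; lia.
have Csv := IH _ _ _ (leq_trans (leq_ltn_trans len_v (ltnSn _))
  (leq_trans (eq_leq size_r) le_m)) longer_v Cg Cv.
have CghV : cell w (g * h * b'^-1) by apply: cell_rmul => //; apply: gen_V.
have := cell_Ms CghV CnV; rewrite -kE -rE -mulgA (s_sqr cox) mulg1 rE.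
case=> /(cell_disjoint Csv) E.
  by move: longer; rewrite -E mulgA (s_sqr cox) mul1g E; lia.
by move: longer_v; rewrite E; lia.
Qed.

Lemma cell_longer_r i w g h : len (w * s i) = (len w).+1 ->
  cell w g -> cell (s i) h -> cell (w * s i) (g * h).
Proof.
move=> longer /cellV Cg /cellV; rewrite (s_inv cox) => Ch.
rewrite -[g * h]invgK -[w * s i]invgK; apply: cellV.
rewrite !invMg (s_inv cox); apply: cell_longer => //.
by rewrite coxlenV // -longer -(coxlenV cox (w * s i)) invMg (s_inv cox).
Qed.

Lemma cell_y i a : a != 0%R -> cell (s i) (y i a).
Proof.
move=> a0; have na0 : (- a^-1 != 0)%R by rewrite oppr_eq0 invr_eq0.
rewrite y_pin_n //; apply: cell_rmul; first exact: x_B.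
apply: cell_lmul; first exact: x_B.
by rewrite -(weyl_pin_n i na0); apply: cell_N; apply: pin_n_N.
Qed.

(* Since [y 1 * y 1 = y 2], the product of the cell of [s i] with itself meets
   that cell; comparing the two ways to multiply by [y 1] an element of the
   cell of [w * s t] yields the exchange condition. *)
Lemma exchange i t w : len (s i * w) = (len w).+1 ->
  len (w * s t) = (len (s i * (w * s t))).+1 -> s i * w = w * s t.
Proof.
set v := s i * (w * s t) => longer shorter.
have wtE : w * s t = s i * v by rewrite /v mulgA (s_sqr cox) mul1g.
have longer_v : len (s i * v) = (len v).+1 by rewrite -wtE.
have y1 : cell (s i) (y i 1%R) by apply: cell_y; rewrite oner_eq0.
have y2 : cell (s i) (y i (1 + 1)%R) by apply: cell_y;
  rewrite -mulr2n pnatr_eq0.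
have [nv Nv nvE] := weyl_onto v.
have Cv : cell v nv by rewrite -nvE; apply: cell_N.
have := cell_longer longer_v y2 Cv; have := cell_longer longer_v y1 Cv.
rewrite pg_yD -mulgA -wtE; set k := _ * nv => Ck Cyk.
have [nw Nw nwE] := weyl_onto w.
have [nt Nt ntE] := weyl_onto (s t).
have Nwt : N (nw * nt) by apply: gen_M.
have nwtE : weyl (nw * nt) = w * s t by rewrite pg_weylM // ntE nwE.
have [b [b' [Bb Bb' kE]]] := cell_rep Nwt nwtE Ck.
have Cw : cell w (b * nw) by apply: cell_lmul => //; rewrite -nwE;
  apply: cell_N.
have Ct : cell (s t) (nt * b').
  by apply: cell_rmul => //; rewrite -ntE; apply: cell_N.
have := cell_Ms (cell_longer longer y1 Cw) Ct.
rewrite (_ : _ * _ = y i 1%R * k); last by rewrite kE !mulgA.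
case=> /(cell_disjoint Cyk) // E.
by have := coxlen_sM_neq cox (i := i) (w := w * s t); rewrite mulgA -E.
Qed.

Lemma bruhat g : exists w, cell w g.
Proof.
(* An equivalence rather than an implication, so that [A] is closed under inverses. *)
pose A : set G := fun g => forall h, (exists w, cell w h) <-> exists w,
  cell w (g * h).
suff Ag : A g.
  have /Ag : exists w, cell w 1 by exists 1; apply/cell1; apply: gen_1.
  by rewrite mulg1.
apply: gen_min (pg_gen g) => [|z zS]; first split=> [h | u v Au Av h | u Au h].
- by rewrite mul1g.
- by rewrite -mulgA Av Au.
- by rewrite (Au (u^-1 * h)) mulVKg.
have step (u : G) : (B u \/ exists i, cell (s i) u) ->
    forall h, (exists w, cell w h) -> exists w, cell w (u * h).
  move=> [Bz | [i Cz]] h [w Cw]; first by exists w; apply: cell_lmul.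
  by case: (cell_sM Cz Cw); [exists w | exists (s i * w)].
suff zP : (B z \/ exists i, cell (s i) z) /\ (B z^-1 \/ exists i,
  cell (s i) z^-1).
  by move=> h; split=> [/step|/step]; [|rewrite -{2}(mulKg z h)]; apply;
    apply zP.
case: zS => [[i [a ->]] | [i [a ->]]].
  by rewrite -pg_xN; split; left; apply: x_B.
rewrite -pg_yN; have [->|a0] := eqVneq a 0%R.
  by rewrite oppr0 pg_y0; split; left; apply: gen_1.
by split; right; exists i; apply: cell_y; rewrite ?oppr_eq0.
Qed.

(** B is its own normalizer. If h normalizes B and lies in the cell of w = v s_t with v shorter,
    conjugating x_t(1) by h shows that a representative of v conjugates y_t(-1) into B. Then its
    product with y_t(-1) lies both in the cell of v and in that of v s_t. *)
Lemma borel_normalizer g g' : conj_set g B = conj_set g' B -> B (g * g'^-1).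
Proof.
move=> E; set h := g * _.
have norm b : B b -> B (h * b * h^-1).
  move=> Bb; have : conj_set g' B (g'^-1 * b * g') by exists b.
  rewrite -E => -[b' Bb' b'E].
  have -> : h * b * h^-1 = g * (g'^-1 * b * g') * g^-1.
    by rewrite /h invMg invgK !mulgA.
  by rewrite -b'E !mulgA mulgK mulgV mul1g.
have [w Ch] := bruhat h.
have [r rE size_r] := reduced_word cox w; case/lastP: r rE size_r => [|r t].
  by rewrite wprod_nil => w1 _; apply/cell1; rewrite w1.
rewrite wprod_rcons size_rcons; set v := wprod s r => rE size_r; exfalso.
have longer : len (v * s t) = (len v).+1.
  by have := coxlen_Ms cox t v; have := coxlen_le s r; rewrite -/v rE; lia.
have [nv Nv nvE] := weyl_onto v.
have [nt [Nt ntE ntx]] : exists nt,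
    [/\ N nt, weyl nt = s t & nt * x t 1%R * nt^-1 = y t (-1)%R].
  exists (n_ t 1%R); split; [by apply: pin_n_N;
    rewrite oner_eq0 | exact: pg_weyl_n |].
  have := @pg_n_x _ _ _ _ G t 1%R 1%R (oner_neq0 _).
  by rewrite expr1n invr1 mulr1.
have Nw : N (nv * nt) by apply: gen_M.
have nwE : weyl (nv * nt) = w by rewrite pg_weylM // ntE nvE.
have [b [b' [Bb Bb' hE]]] := cell_rep Nw nwE Ch.
have : B (nv * y t (-1)%R * nv^-1).
  rewrite -ntx.
  rewrite (_ : _ * _ * _ = b^-1 * (h * (b'^-1 * x t 1%R * b') * h^-1) * b).
    apply: gen_M => //; apply: gen_M; first exact: gen_V.
    apply: norm; apply: gen_M => //; apply: gen_M; [exact: gen_V | exact: x_B].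
  by rewrite hE !invMg !mulgA !(mulgVK, mulgK) mulVg mul1g.
set z := _ * nv^-1 => Bz.
have Cnv : cell v nv by rewrite -nvE; apply: cell_N.
have Cy : cell (s t) (y t (-1)%R) by apply: cell_y; rewrite oppr_eq0 oner_eq0.
have := cell_longer_r longer Cnv Cy.
rewrite (_ : _ * _ = z * nv); last by rewrite mulgVK.
by move/(cell_disjoint (cell_lmul Bz Cnv)) => vE; move: longer; rewrite -vE;
  lia.
Qed.

End BNPair.

(** * Reduced words and the longest element *)

Section BraidEquivalence.
Local Open Scope group_scope.
Variables (I : finType) (gT : finGroupType) (s : I -> gT).

(** Only moves that keep the length occur; each of them lifts to a change of coordinates in
    [braid_eq_lift]. *)
Inductive braid_eq : seq I -> seq I -> Prop :=
| BraidRefl r : braid_eq r r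
| BraidTrans r r' r'' : braid_eq r r' -> braid_eq r' r'' -> braid_eq r r''
| Braid2 p q i j : dot s i j = 0 ->
    braid_eq (p ++ [:: i, j & q]) (p ++ [:: j, i & q])
| Braid3 p q i j : dot s i j = (-1)%R ->
    braid_eq (p ++ [:: i, j, i & q]) (p ++ [:: j, i, j & q]).

Lemma braid_eq_cons i r r' : braid_eq r r' -> braid_eq (i :: r) (i :: r').
Proof.
elim=> {r r'} [r | r r' r'' _ IH _ IH' | p q j k E | p q j k E].
- exact: BraidRefl.
- exact: BraidTrans IH IH'.
- exact: (Braid2 (i :: p)).
- exact: (Braid3 (i :: p)).
Qed.

End BraidEquivalence.

(** * Consequences of the exchange condition: Matsumoto's theorem and the longest element *)

Section LongestElement.
Local Open Scope group_scope.
Variables (I : finType) (gT : finGroupType) (s : I -> gT).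
Hypothesis cox : coxeter_system s.
Hypothesis simply_laced :
  forall i j, i != j -> #[s i * s j]%g = 2%N \/ #[s i * s j]%g = 3%N.
Local Notation len := (coxlen s).
Hypothesis exch : forall i t w, len (s i * w) = (len w).+1 ->
  len (w * s t) = (len (s i * (w * s t))).+1 -> s i * w = w * s t.

(** The exchange condition applies at the last letter if [s i] lengthens the prefix before it;
    otherwise that prefix is already shortened and induction applies to it. *)
Lemma word_exchange i r : reduced s r ->
  (len (s i * wprod s r) < len (wprod s r))%N ->
  exists p t q, r = p ++ t :: q /\ s i * wprod s p = wprod s p * s t.
Proof.
elim/last_ind: r => [|r t IH] red; first by rewrite wprod_nil (coxlen1 s).
have red_r : reduced s r by apply: (@reduced_catl _ _ _ cox r [:: t]);
  rewrite cats1.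
rewrite wprod_rcons => lt_i; case: (coxlen_sM cox i (wprod s r)) => E.
  exists r, t, [::]; rewrite cats1; split=> //; apply: exch => //.
  by have := coxlen_sM cox i (wprod s r * s t); lia.
have [|p [t' [q [rE pE]]]] := IH red_r; first by lia.
by exists p, t', (rcons q t); rewrite rE rcons_cat.
Qed.

Lemma delete_letter i p t q : s i * wprod s p = wprod s p * s t ->
  s i * wprod s (p ++ t :: q) = wprod s (p ++ q).
Proof.
move=> E; rewrite !wprod_cat wprod_cons !mulgA E -!mulgA (mulgA (s t)).
by rewrite (s_sqr cox) mul1g.
Qed.

Lemma s_inj : injective s.
Proof.
move=> i j E; apply: contraTeq isT => /simply_laced.
by rewrite E (s_sqr cox) order1 => -[].
Qed.

Lemma dot_cases i j : i != j ->
  dot s i j = 0 /\ s i * s j = s j * s i \/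
  [/\ dot s i j = (-1)%R, s i * s j * s i = s j * s i * s j
    & s i * s j <> s j * s i].
Proof.
move=> ij; rewrite /dot (negPf ij).
have V : (s i * s j)^-1 = s j * s i by rewrite invMg !(s_inv cox).
have [o|o] := simply_laced ij; have := expg_order (s i * s j); rewrite o.
  rewrite expgS expg1 => /eqP; rewrite -eq_invg_mul V => /eqP com.
  left; split=> //; case: eqP => // E3; case/eqP: ij; apply: s_inj.
  by apply: (mulgI (s j * s i)); rewrite -E3 com.
rewrite 2!expgS expg1 => E; right.
have E3 : s i * s j * s i = s j * s i * s j.
  apply: (mulIg (s j * (s i * s j))); rewrite !mulgA in E *; rewrite E.
  by rewrite -(mulgA (s j * s i)) (s_sqr cox) mulg1 -(mulgA (s j)) (s_sqr cox)
    mulg1 (s_sqr cox).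
split=> //; first by rewrite E3 eqxx.
move=> com; have a2 : s i * s j * (s i * s j) = 1.
  by rewrite {2}com mulgA -(mulgA (s i)) (s_sqr cox) mulg1 (s_sqr cox).
by move: E o; rewrite a2 mulg1 => ->; rewrite order1.
Qed.

Lemma reduced_of r r' : reduced s r -> wprod s r = wprod s r' ->
  size r' = size r -> reduced s r'.
Proof. by rewrite /reduced => -> <-. Qed.

Lemma tail_shorter i r : reduced s (i :: r) ->
  (len (s i * wprod s (i :: r)) < len (wprod s (i :: r)))%N.
Proof.
move=> red; have [red_r E] := reduced_cons cox red.
by rewrite wprod_cons mulgA (s_sqr cox) mul1g E.
Qed.

(* Matsumoto's theorem. *)
Lemma reduced_braid_eq r r' : reduced s r -> reduced s r' ->
  wprod s r = wprod s r' -> braid_eq s r r'.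
Proof.
have [m] := ubnP (size r); elim: m => // m IH in r r' *.
move=> le_m red red' E; have sizeE : size r' = size r by rewrite red red' E.
case: r r' => [|i r] [|j r'] // in le_m red red' E sizeE *;
  first exact: BraidRefl.
move: le_m; rewrite /= ltnS => le_m.
have IHc k u u' : (size u < m)%N -> reduced s (k :: u) -> reduced s (k :: u') ->
    wprod s (k :: u) = wprod s (k :: u') -> braid_eq s (k :: u) (k :: u').
  move=> lt_u /(reduced_cons cox) [red_u _] /(reduced_cons cox) [red_u' _].
  rewrite !wprod_cons => /mulgI Eu; apply: braid_eq_cons; exact: IH.
have [ij|ij] := eqVneq i j; first by rewrite ij in red E *; apply: IHc.
have s_ij : s i <> s j by move/s_inj/eqP; rewrite (negPf ij).
(* The element also has a reduced word starting with [j]. Exchanging [j] into [i :: r] deletes a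
   letter other than the leading [i], since [s i] and [s j] differ; the new word begins with
   [j, i]. *)
have [||p [t [q [rE pE]]]] := @word_exchange j (i :: r) => //.
  by rewrite E; apply: tail_shorter.
case: p rE pE => [|i' p] /= [] itE rE; rewrite ?wprod_nil ?mulg1 ?mul1g => pE.
  by case: s_ij; rewrite pE itE.
subst i'; pose r2 := p ++ q.
have size_r : size r = (size r2).+1 by rewrite rE !size_cat /= addnS.
have E2 : wprod s (i :: r) = wprod s [:: j, i & r2].
  rewrite [RHS]wprod_cons -[i :: r2]/((i :: p) ++ q) -(delete_letter q pE).
  by rewrite /= -rE mulgA (s_sqr cox) mul1g.
have red2 : reduced s [:: j, i & r2].
  by apply: reduced_of red E2 _; rewrite /= size_r.
have [[dot0 com]|[dot1 br ncom]] := dot_cases ij.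
  have E3 : wprod s [:: i, j & r2] = wprod s [:: j, i & r2].
    by rewrite !wprod_cons !mulgA com.
  have red3 : reduced s [:: i, j & r2] by apply: reduced_of red2 (esym E3) _.
  apply: (BraidTrans (r' := [:: i, j & r2])).
    by apply: IHc => //; rewrite E2 E3.
  apply: (BraidTrans (r' := [:: j, i & r2])); first exact: (Braid2 [::]).
  by apply: IHc => //; rewrite /= -?size_r // -E2 E.
(* Now [i] is exchanged into [j, i, r2]. Deleting [j] would give equal reflections, and deleting the
   next [i] would make them commute, so the new word begins with [i, j, i] and a braid move
   applies. *)
have [||p' [t' [q' [rE' pE']]]] := @word_exchange i [:: j, i & r2] => //.
  by rewrite -E2; apply: tail_shorter.
case: p' rE' pE' => [|j' [|i' p']] /= [] jE.
- by rewrite ?wprod_nil ?mulg1 ?mul1g -jE => _ /s_ij.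
- move=> <- _; rewrite -jE !wprod_cons wprod_nil mulg1 => com; by case: ncom.
move=> iE rE'; subst i' j' => pE'; pose r3 := p' ++ q'.
have size_r2 : size r2 = (size r3).+1 by rewrite rE' !size_cat /= addnS.
have E3 : wprod s (i :: r) = wprod s [:: i, j, i & r3].
  rewrite [RHS]wprod_cons -[[:: j, i & r3]]/([:: j,
    i & p'] ++ q') -(delete_letter q' pE').
  by rewrite /= -rE' mulgA (s_sqr cox) mul1g.
have red3 : reduced s [:: i, j, i & r3].
  by apply: reduced_of red E3 _; rewrite /= size_r size_r2.
have E4 : wprod s [:: i, j, i & r3] = wprod s [:: j, i, j & r3].
  by rewrite !wprod_cons !mulgA br.
have red4 : reduced s [:: j, i, j & r3] by apply: reduced_of red3 E4 _.
apply: (BraidTrans (r' := [:: i, j, i & r3])); first exact: IHc.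
apply: (BraidTrans (r' := [:: j, i, j & r3])); first exact: (Braid3 [::]).
by apply: IHc => //; rewrite /= -?size_r2 -?size_r // -E4 -E3 E.
Qed.

Local Notation w0 := (w0 s).
Local Notation nu := (nu s).

Lemma nu_max w : (len w <= nu)%N.
Proof. by rewrite /nu /w0; case: arg_maxnP => // v _; apply. Qed.

Lemma cat_eq_cat (A : Type) (r u p q : seq A) t : r ++ u = p ++ t :: q ->
  (exists q', r = p ++ t :: q') \/ (exists p', p = r ++ p' /\ u = p' ++ t :: q).
Proof.
elim: r p => [|a r IH] [|b p] /=; first by right; exists [::].
- by right; exists (b :: p).
- by case=> -> _; left; exists r.
case=> -> /IH [[q' ->] | [p' [-> ->]]]; first by left; exists q'.
by right; exists p'.
Qed.

(** Induction on a reduced word of w = s_i w', where w0 = w' u. As s_i shortens w0, exchange deletes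
    a letter from the concatenated words of w' and u. It cannot come from w', because [i :: r] is
    reduced; what is left of u is the new cofactor. *)
Lemma w0_extend w : exists2 u, w0 = w * u & (len w + len u = nu)%N.
Proof.
have [r] := reduced_word cox w; elim: r w => [|i r IH] w rE size_r.
  by exists w0; rewrite -rE wprod_nil ?mul1g ?(coxlen1 s).
have red : reduced s (i :: r) by rewrite /reduced size_r rE.
have [red_r len_i] := reduced_cons cox red.
have [u w0E lenE] := IH _ (erefl _) red_r.
have [ru ruE size_ru] := reduced_word cox u.
have w0E' : w0 = wprod s (r ++ ru) by rewrite wprod_cat ruE.
have red0 : reduced s (r ++ ru).
  by rewrite /reduced -w0E' size_cat size_ru red_r.
have [|p [t [q [pqE pE]]]] := word_exchange (i := i) red0.
  by rewrite -w0E'; have := nu_max (s i * w0); have := coxlen_sM cox i w0;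
    rewrite /nu; lia.
have del := delete_letter q pE; rewrite -pqE -w0E' in del.
have [[q' rE'] | [p' [pE' ruE']]] := cat_eq_cat pqE.
  have := coxlen_le s (p ++ q'); rewrite -(delete_letter _ pE) -rE' len_i
    -red_r.
  by rewrite rE' !size_cat /=; lia.
have w0E2 : w0 = w * wprod s (p' ++ q).
  rewrite -rE wprod_cons -mulgA -wprod_cat catA -pE' -del mulgA (s_sqr cox).
  by rewrite mul1g.
exists (wprod s (p' ++ q)) => //.
have := coxlenM cox w (wprod s (p' ++ q)); rewrite -w0E2 -/nu.
have := coxlen_le s (p' ++ q).
have := congr1 size ruE'; rewrite !size_cat /= size_ru -size_r /= => sz.
by move: lenE; rewrite -red_r; lia.
Qed.

Lemma w0_unique w : len w = nu -> w = w0.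
Proof.
move=> E; have [u ->] := w0_extend w; rewrite E => lenE.
by rewrite (@coxlen_eq0 _ _ _ cox u) ?mulg1 //; lia.
Qed.

Lemma w0V : w0^-1 = w0.
Proof. by apply: w0_unique; rewrite coxlenV. Qed.

(** The length of [s i * w0] is one less than [nu], so its cofactor in [w0_extend] is a single
    letter. Hence the search in [bang] succeeds and its default is never taken. *)
Lemma bangE i : s i * w0 = w0 * s (bang s i).
Proof.
suff [t tE] : exists t, s i * w0 = w0 * s t.
  by rewrite /bang; case: pickP => [j /eqP // | /(_ t)]; rewrite tE eqxx.
have len_i : nu = (len (s i * w0)).+1.
  by have := nu_max (s i * w0); have := coxlen_sM cox i w0; rewrite /nu; lia.
have [u uE lenE] := w0_extend (s i * w0).
have [[|t [|//]] rE size_r] := reduced_word cox u; move: size_r => /= size_r;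
  try lia.
exists t; rewrite {2}uE -rE wprod_cons wprod_nil mulg1 -!mulgA (s_sqr cox).
by rewrite mulg1.
Qed.

Lemma bangK : involutive (bang s).
Proof.
move=> i; apply: s_inj; apply: (mulgI w0); rewrite -bangE.
by rewrite -{1}w0V -(s_inv cox (bang s i)) -invMg -bangE invMg w0V (s_inv cox).
Qed.

End LongestElement.

(** * Subtraction-free expressions and changes of coordinates *)

Section SemifieldTheory.
Local Open Scope ring_scope.
Variable K : semifield.
Implicit Types a b c : K.

Lemma sf_mulr1 a : sf_mul a sf_one = a.
Proof. by rewrite sf_mulC sf_mul1. Qed.

Lemma sf_mulrV a : sf_mul a (sf_inv a) = sf_one.
Proof. by rewrite sf_mulC sf_mulV. Qed.

Lemma sf_mulVKr a b : sf_mul (sf_mul a (sf_inv b)) b = a.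
Proof. by rewrite -sf_mulA sf_mulV sf_mulr1. Qed.

Lemma sf_mulKr a b : sf_mul (sf_mul a b) (sf_inv b) = a.
Proof. by rewrite -sf_mulA sf_mulrV sf_mulr1. Qed.

Lemma sf_mulKV a b : sf_mul b (sf_mul a (sf_inv b)) = a.
Proof. by rewrite sf_mulC sf_mulVKr. Qed.

Lemma sf_mulCA a b c : sf_mul a (sf_mul b c) = sf_mul b (sf_mul a c).
Proof. by rewrite !sf_mulA (sf_mulC a). Qed.

Lemma sf_mulACA a b c d :
  sf_mul (sf_mul a b) (sf_mul c d) = sf_mul (sf_mul a c) (sf_mul b d).
Proof. by rewrite -!sf_mulA (sf_mulCA b). Qed.

Lemma sf_mulDr a b c : sf_mul a (sf_add b c) = sf_add (sf_mul a b) (sf_mul a c).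
Proof. by rewrite !(sf_mulC a) sf_mulDl. Qed.

Lemma sf_mulIr a b c : sf_mul a c = sf_mul b c -> a = b.
Proof. by move=> E; rewrite -(sf_mulKr a c) E sf_mulKr. Qed.

(** Degree one homogeneity of the outer coordinates of a braid move. *)
Lemma sf_braid_homogeneous a b c d e :
  sf_mul (sf_mul (sf_mul c a) (sf_mul c b))
    (sf_inv (sf_add (sf_mul c d) (sf_mul c e))) =
  sf_mul c (sf_mul (sf_mul a b) (sf_inv (sf_add d e))).
Proof.
apply: (@sf_mulIr _ _ (sf_mul c (sf_add d e))).
by rewrite -sf_mulDr sf_mulVKr sf_mulACA [RHS]sf_mulACA sf_mulVKr.
Qed.

End SemifieldTheory.

Section Substitution.
Local Open Scope ring_scope.

Fixpoint sfsubst m n (P : 'I_m -> sfexpr n) (e : sfexpr m) : sfexpr n :=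
  match e with
  | SfVar l => P l
  | SfOne => SfOne
  | SfAdd e1 e2 => SfAdd (sfsubst P e1) (sfsubst P e2)
  | SfMul e1 e2 => SfMul (sfsubst P e1) (sfsubst P e2)
  | SfInv e1 => SfInv (sfsubst P e1)
  end.

Lemma sfeval_subst (K : semifield) m n (P : 'I_m -> sfexpr n) (a : 'I_n ->
  K) e :
  sfeval a (sfsubst P e) = sfeval (fun l => sfeval a (P l)) e.
Proof. by elim: e => //= [e1 -> e2 -> | e1 -> e2 -> | e1 ->]. Qed.

Lemma eq_sfeval (K : semifield) n (a b : 'I_n -> K) e :
  a =1 b -> sfeval a e = sfeval b e.
Proof. by move=> ab; elim: e => //= [e1 -> e2 -> | e1 -> e2 -> | e1 ->]. Qed.

End Substitution.

(* The value of a subtraction-free expression as a fraction whose numerator and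
   denominator are polynomials with coefficients in the natural numbers. *)
Section Fractions.
Local Open Scope ring_scope.

Fixpoint sffrac (R : comPzRingType) n (a : 'I_n -> R) (e : sfexpr n) : R * R :=
  match e with
  | SfVar l => (a l, 1)
  | SfOne => (1, 1)
  | SfAdd e1 e2 => let u := sffrac a e1 in let v := sffrac a e2 in
      (u.1 * v.2 + v.1 * u.2, u.2 * v.2)
  | SfMul e1 e2 => let u := sffrac a e1 in let v := sffrac a e2 in
      (u.1 * v.1, u.2 * v.2)
  | SfInv e1 => let u := sffrac a e1 in (u.2, u.1)
  end.

Lemma sffrac_morph (R S : comPzRingType) (f : {rmorphism R -> S}) n
    (a : 'I_n -> R) e :
  sffrac (fun l => f (a l)) e = (f (sffrac a e).1, f (sffrac a e).2).
Proof.
elim: e => //= [l | | e1 -> e2 -> | e1 -> e2 -> | e1 ->] //=;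
  by rewrite ?rmorphD ?rmorphM ?rmorph1.
Qed.

Lemma eq_sffrac (R : comPzRingType) n (a b : 'I_n -> R) e :
  a =1 b -> sffrac a e = sffrac b e.
Proof. by move=> ab; elim: e => /= [l | | e1 -> e2 -> | e1 -> e2 ->
  | e1 ->] //; rewrite ab. Qed.

Lemma sfeval_frac (k : realFieldType) n (a : 'I_n -> pos_semifield k) e :
  let u := sffrac (fun l => pos_val (a l)) e in
  [/\ 0 < u.1, 0 < u.2 & pos_val (sfeval a e) = u.1 / u.2].
Proof.
elim: e => /= [l | | e1 [n1 d1 E1] e2 [n2 d2 E2] | e1 [n1 d1 E1] e2 [n2 d2 E2]
  | e1 [n1 d1 E1]].
- by rewrite divr1; split=> //; apply: pos_valP.
- by rewrite divr1.
- rewrite E1 E2; split; rewrite ?addr_gt0 ?mulr_gt0 //.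
  by field; rewrite !gt_eqF.
- rewrite E1 E2; split; rewrite ?mulr_gt0 //.
  by field; rewrite !gt_eqF.
- by rewrite E1 invf_div.
Qed.

(** Cross-multiplied difference of two fractions: an integral polynomial, so it makes sense in the
    integers and in polynomial rings as well. *)
Definition sfcross (R : comPzRingType) n (e e' : sfexpr n) (a : 'I_n ->
  R) : R :=
  (sffrac a e).1 * (sffrac a e').2 - (sffrac a e').1 * (sffrac a e).2.

Lemma sfcross_morph (R S : comPzRingType) (f : {rmorphism R -> S}) n e e'
    (a : 'I_n -> R) : sfcross e e' (fun l => f (a l)) = f (sfcross e e' a).
Proof. by rewrite /sfcross !sffrac_morph /= rmorphB !rmorphM. Qed.

Lemma eq_sfcross (R : comPzRingType) n e e' (a b : 'I_n -> R) :
  a =1 b -> sfcross e e' a = sfcross e e' b.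
Proof. by move=> ab; rewrite /sfcross !(eq_sffrac _ ab). Qed.

Lemma sfeval_eq_cross (k : realFieldType) n e e' (a : 'I_n -> pos_semifield k) :
  sfeval a e = sfeval a e' <-> sfcross e e' (fun l => pos_val (a l)) = 0.
Proof.
have [n1 d1 E1] := sfeval_frac a e; have [n2 d2 E2] := sfeval_frac a e'.
have {d1}d1 := lt0r_neq0 d1; have {d2}d2 := lt0r_neq0 d2.
rewrite /sfcross; split=> [/(congr1 (@pos_val k)) | /eqP].
  by rewrite E1 E2 => /eqP; rewrite eqr_div // => /eqP ->; rewrite subrr.
rewrite subr_eq0 -eqr_div // -E1 -E2 => /eqP E; exact: val_inj.
Qed.

Lemma poly_eq0_nat (k : realFieldType) (p : {poly k}) :
  (forall t : nat, p.[t.+1%:R] = 0) -> p = 0.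
Proof.
move=> p0; apply: (@roots_geq_poly_eq0 _ p [seq t.+1%:R | t <- iota 0 (size
  p)]).
- by apply/allP => _ /mapP [t _ ->]; apply/eqP.
- rewrite map_inj_uniq ?iota_uniq // => t u /eqP.
  by rewrite eqr_nat eqSS => /eqP.
- by rewrite size_map size_iota.
Qed.

(* A polynomial identity valid at all points with positive integral coordinates
   is valid everywhere: free the coordinates one after the other. *)
Lemma sfeval_transfer (Re k : realFieldType) n (e e' : sfexpr n) :
  (forall a : 'I_n -> pos_semifield Re, sfeval a e = sfeval a e') ->
  forall a : 'I_n -> pos_semifield k, sfeval a e = sfeval a e'.
Proof.
move=> E a; apply/sfeval_eq_cross; move: {a}(fun l => _) => a.
have nat0 (b : 'I_n -> nat) : sfcross e e' (fun l => (b l).+1%:R : k) = 0.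
  (* The integers connect the two fields: the value at an integral point is an integer, which is
     zero because its image in [Re] is. *)
  have Z0 : sfcross e e' (fun l => (b l).+1%:Z) = 0.
    pose c l : pos_semifield Re := Pos (ltr0Sn Re (b l)).
    have /sfeval_eq_cross := E c.
    rewrite -(@eq_sfcross _ _ _ _ (fun l => (b l).+1%:Z%:~R)) //.
    by rewrite (sfcross_morph intr) => /eqP; rewrite intr_eq0 => /eqP.
  rewrite -(@eq_sfcross _ _ _ _ (fun l => (b l).+1%:Z%:~R)) //.
  by rewrite (sfcross_morph intr) Z0.
(* The coordinates of index below [m] are arbitrary, the remaining ones are still positive
   integers. *)
suff part m : forall b : 'I_n -> nat,
    sfcross e e' (fun l => if (l < m)%N then a l else (b l).+1%:R) = 0.
  by have := part n (fun=> 0%N); under eq_sfcross => l do rewrite ltn_ord.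
elim: m => [|m IH] b; first exact: nat0.
(* Coordinate [m] becomes an indeterminate; by induction the resulting polynomial vanishes at all
   positive integers. *)
pose aX (l : 'I_n) : {poly k} :=
  if (l < m)%N then (a l)%:P else if l == m :> nat then 'X else (b l).+1%:R%:P.
have evalX t : (sfcross e e' aX).[t] = sfcross e e' (fun l : 'I_n =>
    if (l < m)%N then a l else if l == m :> nat then t else (b l).+1%:R).
  rewrite -/(horner_eval t _) -(sfcross_morph (horner_eval t)).
  apply: eq_sfcross => l; rewrite /aX.
  by case: ifP => _; [|case: ifP => _];
    rewrite /= horner_evalE ?hornerC ?hornerX.
have X0 : sfcross e e' aX = 0.
  apply: poly_eq0_nat => t; rewrite evalX.
  rewrite -[RHS](IH (fun l => if l == m :> nat then t else b l)).
  by apply: eq_sfcross => l; case: ifP => // _; case: ifP.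
have [m_n | n_m] := ltnP m n.
  have := evalX (a (Ordinal m_n)); rewrite X0 horner0 => ->.
  apply: eq_sfcross => l; rewrite ltnS leq_eqVlt.
  have [lm | neq] := eqVneq (l : nat) m; last by case: ifP.
  by rewrite lm ltnn /=; congr a; apply: val_inj.
rewrite -[RHS](IH b); apply: eq_sfcross => l.
by rewrite !(leq_trans (ltn_ord l)) // ltnW.
Qed.

End Fractions.

(** * Braid moves on words carrying symbolic coordinates *)

Section SubtractionFreeWords.
Local Open Scope ring_scope.
Variables (I : finType) (gT : finGroupType) (s : I -> gT) (n : nat).
Local Notation sfword := (seq (I * sfexpr n)).

(** The new coordinates are the explicit solution bc/(a+c), a+c, ab/(a+c) of the braid relation, so
    that one tuple of expressions serves all semifields and the real group. *)
Inductive sf_eq : sfword -> sfword -> Prop :=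
| SfRefl w : sf_eq w w
| SfTrans w w' w'' : sf_eq w w' -> sf_eq w' w'' -> sf_eq w w''
| Sf2 p q i j a b : dot s i j = 0 ->
    sf_eq (p ++ [:: (i, a), (j, b) & q]) (p ++ [:: (j, b), (i, a) & q])
| Sf3 p q i j a b c : dot s i j = -1 ->
    sf_eq (p ++ [:: (i, a), (j, b), (i, c) & q])
      (p ++ [:: (j, SfMul (SfMul b c) (SfInv (SfAdd a c))), (i, SfAdd a c),
             (j, SfMul (SfMul a b) (SfInv (SfAdd a c))) & q]).

Lemma unzip1_eq_cat (A : Type) (w : seq (I * A)) p q : unzip1 w = p ++ q ->
  exists w1 w2, [/\ w = w1 ++ w2, unzip1 w1 = p & unzip1 w2 = q].
Proof.
elim: p w => [|i p IH] w /=; first by move=> <-; exists [::], w.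
case: w => [|[j a] w] //= [-> /IH [w1 [w2 [-> <- <-]]]].
by exists ((i, a) :: w1), w2.
Qed.

Lemma braid_eq_lift r r' : braid_eq s r r' -> forall w : sfword, unzip1 w = r ->
  exists2 w', unzip1 w' = r' & sf_eq w w'.
Proof.
elim=> {r r'} [r w <- | r r' r'' _ IH _ IH' w /IH [w' /IH' [w'' w''E ww'] ww] |
  p q i j E w /unzip1_eq_cat [w1 [w2 [-> <-]]] |
  p q i j E w /unzip1_eq_cat [w1 [w2 [-> <-]]]].
- by exists w => //; apply: SfRefl.
- by exists w'' => //; apply: SfTrans ww ww'.
- case: w2 => [|[? a] [|[? b] w2]] //= [-> -> <-].
  exists (w1 ++ [:: (j, b), (i, a) & w2]); last exact: Sf2.
  by rewrite /unzip1 map_cat.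
- case: w2 => [|[? a] [|[? b] [|[? c] w2]]] //= [-> -> -> <-].
  eexists; last exact: Sf3.
  by rewrite /unzip1 map_cat.
Qed.

Definition evalw (K : semifield) (a : 'I_n -> K) (w : sfword) : seq (I * K) :=
  [seq (p.1, sfeval a p.2) | p <- w].

Lemma sf_eq_cong (K : semifield) (a : 'I_n -> K) w w' : sf_eq w w' ->
  word_cong s (evalw a w) (evalw a w').
Proof.
elim=> {w w'} [w | w w' w'' _ IH _ IH' | p q i j b c E | p q i j b c d E].
- exact: CongRefl.
- exact: CongTrans IH IH'.
- rewrite /evalw !map_cat; apply: CongCat; first exact: CongRefl.
  rewrite -[X in word_cong _ X _]/([:: _; _] ++ _).
  rewrite -[X in word_cong _ _ X]/([:: _; _] ++ _).
  apply: CongCat; last exact: CongRefl.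
  by apply: CongRel; apply: WordComm.
- rewrite /evalw !map_cat; apply: CongCat; first exact: CongRefl.
  rewrite -[X in word_cong _ X _]/([:: _; _; _] ++ _).
  rewrite -[X in word_cong _ _ X]/([:: _; _; _] ++ _).
  apply: CongCat; last exact: CongRefl.
  apply: CongRel; apply: WordBraid => //=; first by rewrite sf_mulKV.
  by rewrite sf_mulVKr.
Qed.

(** Homogeneity is carried along the moves as a property of words; it is trivial for the word of
    variables from which they start. *)
Lemma sf_eq_homogeneous (K : semifield) (c : K) (a : 'I_n ->
  K) w w' : sf_eq w w' ->
  evalw (fun l => sf_mul c (a l)) w =
    [seq (p.1, sf_mul c p.2) | p <- evalw a w] ->
  evalw (fun l => sf_mul c (a l)) w' =
    [seq (p.1, sf_mul c p.2) | p <- evalw a w'].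
Proof.
elim=> {w w'} [w | w w' w'' _ IH _ IH' /IH | p q i j b d E | p q i j b d f E]
  //.
  rewrite /evalw -!map_comp !map_cat /= => /eqP.
  rewrite eqseq_cat ?size_map // => /andP [/eqP -> /eqP /= [-> -> ->]] //.
rewrite /evalw -!map_comp !map_cat /= => /eqP.
rewrite eqseq_cat ?size_map // => /andP [/eqP -> /eqP /= [-> -> -> ->]].
by rewrite !sf_braid_homogeneous sf_mulDr.
Qed.

(** The root subgroups [pg_y] satisfy the same commutation and braid relations as the generators of
    the monoid. *)
Lemma sf_eq_y (Re : realType) (G : pinned_group Re s)
    (a : 'I_n -> pos_semifield Re) w w' : sf_eq w w' ->
  (\prod_(p <- evalw a w) pg_y G p.1 (pos_val p.2))%g =
  (\prod_(p <- evalw a w') pg_y G p.1 (pos_val p.2))%g.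
Proof.
elim=> {w w'} [// | w w' w'' _ -> // | p q i j b c E | p q i j b c d E].
  rewrite /evalw !map_cat !big_cat !big_cons /=; congr (_ * _)%g.
  by rewrite !mulgA (@pg_yC _ _ _ _ G i j _ _ E).
rewrite /evalw !map_cat !big_cat !big_cons /=; congr (_ * _)%g.
rewrite !mulgA; congr (_ * _)%g; apply: pg_y_braid => //=.
all: move: (sfeval a b) (sfeval a c) (sfeval a d) => [b' b0] [c' c0] [d' d0] /=.
all: have bd0 : b' + d' != 0 by rewrite gt_eqF // addr_gt0.
all: by field.
Qed.

End SubtractionFreeWords.

(** * Change of reduced word as a homogeneous tuple of expressions *)

Section ChangeOfReducedWord.
Local Open Scope ring_scope.
Variables (I : finType) (gT : finGroupType) (s : I -> gT).
Hypothesis cox : coxeter_system s.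
Hypothesis simply_laced :
  forall i j, i != j -> #[s i * s j]%g = 2%N \/ #[s i * s j]%g = 3%N.
Hypothesis exch : forall i t w,
  coxlen s (s i * w)%g = (coxlen s w).+1 ->
  coxlen s (w * s t)%g = (coxlen s (s i * (w * s t)))%g.+1 ->
  (s i * w = w * s t)%g.
Local Notation nu := (nu s).

Lemma big_enum_ord (R : Type) (op : R -> R -> R) (x : R) n (F : 'I_n -> R) :
  \big[op/x]_(l <- enum 'I_n) F l = \big[op/x]_(l < n) F l.
Proof. by rewrite enumT /index_enum unlock. Qed.

Lemma red_wordsP (i : nu.-tuple I) : red_words i <-> wprod s i = w0 s.
Proof. by rewrite /red_words /= /wprod big_tuple. Qed.

Lemma red_words_reduced (i : nu.-tuple I) : red_words i -> reduced s i.
Proof. by move/red_wordsP; rewrite /reduced size_tuple => ->. Qed.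

Lemma fcoordE (K : semifield) (i : nu.-tuple I) (a : 'I_nu -> K) :
  fcoord i a = \pi_(fU s K)%qT [seq (tnth i l, a l) | l <- enum 'I_nu].
Proof.
rewrite /fcoord -big_enum_ord; elim: (enum _) => [|l r IH];
  first by rewrite big_nil.
by rewrite big_cons IH; apply: (fU_mulE s [:: _]).
Qed.

Definition var_word (i : nu.-tuple I) : seq (I * sfexpr nu) :=
  [seq (tnth i l, SfVar l) | l <- enum 'I_nu].

(** The default [SfOne] is never read on a word of length [nu]. *)
Definition word_coords (w : seq (I * sfexpr nu)) (l : 'I_nu) : sfexpr nu :=
  nth SfOne (unzip2 w) l.

Lemma unzip1_var_word i : unzip1 (var_word i) = i.
Proof. by rewrite /unzip1 -map_comp /= map_tnth_enum. Qed.

Lemma unzip1_word (i : nu.-tuple I) w : unzip1 w = i ->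
  w = [seq (tnth i l, word_coords w l) | l <- enum 'I_nu].
Proof.
move=> wi; have size_w : size w = nu.
  by have := congr1 size wi; rewrite size_map size_tuple.
case: w wi size_w => [|p0 w0] wi size_w.
  by apply/esym/size0nil; rewrite size_map size_enum_ord -size_w.
set w := p0 :: w0 in wi size_w *.
have l0 : (0 < nu)%N by rewrite -size_w.
pose d := (tnth i (Ordinal l0), @SfOne nu).
apply: (@eq_from_nth _ d); first by rewrite size_map size_enum_ord.
move=> m; rewrite size_w => m_nu.
rewrite (nth_map (Ordinal l0)) ?size_enum_ord // /word_coords.
have -> : nth (Ordinal l0) (enum 'I_nu) m = Ordinal m_nu.
  by apply: val_inj; rewrite /= nth_enum_ord.
rewrite (tnth_nth d.1) -wi (nth_map d) ?size_w // [in RHS](nth_map d) ?size_w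
  //.
by case: (nth _ _ _).
Qed.

Lemma evalw_coords (K : semifield) (a : 'I_nu -> K) (i : nu.-tuple I) w :
  unzip1 w = i ->
  evalw a w = [seq (tnth i l, sfeval a (word_coords w l)) | l <- enum 'I_nu].
Proof. by move=> wi; rewrite {1}(unzip1_word wi) /evalw -map_comp. Qed.

Lemma evalw_var (K : semifield) (a : 'I_nu -> K) (i : nu.-tuple I) :
  evalw a (var_word i) = [seq (tnth i l, a l) | l <- enum 'I_nu].
Proof. by rewrite /evalw /var_word -map_comp. Qed.

(** A chain of braid moves given by Matsumoto's theorem is lifted to the word of variables. The same
    [R] works for every semifield and in the real group, which is what later allows the transfer
    from [Re] to [k]. *)
Lemma change_word (i i' : nu.-tuple I) : red_words i -> red_words i' ->
  exists R : 'I_nu -> sfexpr nu,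
  [/\ forall (K : semifield) (a : 'I_nu -> K),
        fcoord i a = fcoord i' (fun l => sfeval a (R l)),
      forall (K : semifield) (c : K) (a : 'I_nu -> K) l,
        sfeval (fun m => sf_mul c (a m)) (R l) = sf_mul c (sfeval a (R l))
    & forall (Re : realType) (G : pinned_group Re s) (a : 'I_nu ->
      pos_semifield Re),
        ycoord G i a = ycoord G i' (fun l => sfeval a (R l))].
Proof.
move=> red red'.
have ii' : braid_eq s i i'.
  apply: (reduced_braid_eq cox simply_laced exch); try exact: red_words_reduced.
  by move/red_wordsP: red => ->; move/red_wordsP: red' => ->.
have [w wi' iw] := braid_eq_lift ii' (unzip1_var_word i).
exists (word_coords w); split=> [K a | K c a l | Re G a].
- rewrite !fcoordE; apply/fU_eqP; rewrite -evalw_var -(evalw_coords a wi').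
  exact: sf_eq_cong.
- have := @sf_eq_homogeneous _ _ _ _ K c a _ _ iw.
  rewrite !evalw_var !(evalw_coords _ wi') -!map_comp => /(_ (erefl _)).
  have l_enum : l \in Finite.enum 'I_nu by rewrite -enumT mem_enum.
  by move/eq_in_map => /(_ l l_enum) [].
- have := sf_eq_y G a iw; rewrite evalw_var (evalw_coords a wi').
  by rewrite big_map [RHS]big_map !big_enum_ord.
Qed.

End ChangeOfReducedWord.

(** * Opposite half circles in the real group *)

Section ParabolicRadical.
Local Open Scope group_scope.
Variables (F : realFieldType) (I : finType) (gT : finGroupType) (s : I -> gT).
Variable G : pinned_group F s.
Hypothesis cox : coxeter_system s.
Hypothesis simply_laced :
  forall i j, i != j -> #[s i * s j]%g = 2%N \/ #[s i * s j]%g = 3%N.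

Local Notation x := (@pg_x _ _ _ _ G).
Local Notation y := (@pg_y _ _ _ _ G).
Local Notation n_ := (pin_n x y).
Local Notation h_ := (pin_h x y).
Local Notation T := (torus x y).
Local Notation N := (torus_normalizer x y).
Local Notation B := (borel x y x).
Local Notation Bm := (borel x y y).
Local Notation weyl := (@pg_weyl _ _ _ _ G).
Local Notation len := (coxlen s).
Local Notation cell := (@cell _ _ _ _ G).

(** The elements that rescale a root subgroup form a subgroup containing the generators of the
    torus; [z] and [e] are abstract in order to cover both [x] and [y]. *)
Lemma torus_act (z : I -> F -> G) (e : I -> I -> int) :
  (forall i j t a, t != 0%R ->
     h_ i t * z j a * (h_ i t)^-1 = z j (t ^ e i j * a)%R) ->
  forall h j, T h -> exists2 l, l != 0%R & forall r,
    h * z j r * h^-1 = z j (l * r)%R.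
Proof.
move=> hz h j; apply: (@gen_min _ [set h | exists2 l, l != 0%R &
  forall r, h * z j r * h^-1 = z j (l * r)%R]); first split.
- by exists 1%R => [|r]; rewrite ?oner_eq0 // mul1g invg1 mulg1 mul1r.
- move=> g1 g2 [l1 l10 E1] [l2 l20 E2]; exists (l1 * l2)%R;
    first by rewrite mulf_neq0.
  move=> r; rewrite -mulrA -E1 -E2 invMg !mulgA //.
- move=> g [l l0 E]; exists l^-1%R; first by rewrite invr_eq0.
  move=> r; rewrite -{1}[r](mulVKf l0) -E invgK !mulgA mulVg mul1g mulgVK //.
- move=> _ [i [t [t0 ->]]]; exists (t ^ e i j)%R; first exact: expfz_neq0.
  by move=> r; apply: hz.
Qed.

Lemma torus_x h j : T h ->
  exists2 l, l != 0%R & forall r, h * x j r * h^-1 = x j (l * r)%R.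
Proof. by apply: torus_act => i k t a t0; apply: pg_h_x. Qed.

Lemma torus_y h j : T h ->
  exists2 l, l != 0%R & forall r, h * y j r * h^-1 = y j (l * r)%R.
Proof. by apply: (torus_act (e := fun i k => (- dot s i k)%R)) => i k t a t0;
  apply: pg_h_y. Qed.

Lemma torus_conj n h : N n -> T h -> T (n * h * n^-1).
Proof.
move=> Nn Th; have Nh := torus_N Th; have NV : N n^-1 by apply: gen_V.
apply/pg_weyl_ker; first by apply: gen_M => //; apply: gen_M.
have /pg_weyl_ker hE := Th.
by rewrite !pg_weylM ?weylV ?hE ?mulg1 ?mulgV //; apply: gen_M.
Qed.

(* In [SL_2]: the bottom row of [y r * x d] is [(r, 1 + r * d)]. *)
Lemma B_yx j r d : (1 + r * d != 0)%R ->
  B (y j r * x j d * y j (- (r / (1 + r * d)))%R).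
Proof.
move=> rd0; have [->|r0] := eqVneq r 0%R.
  by rewrite mul0r oppr0 pg_y0 mul1g mulg1; apply: x_B.
set r1 := (- _)%R; have r10 : (r1 != 0)%R by rewrite oppr_eq0 mulf_neq0
  ?invr_eq0.
(* Both [y] factors are expanded by [y_pin_n]; [r1] is chosen so that the parameter of the middle
   [x] vanishes, and two adjacent [pin_n] multiply into the torus. *)
have -> : y j r * x j d * y j r1 = x j r^-1%R *
    (n_ j (- r^-1)%R * x j (r^-1 + d + r1^-1)%R * n_ j (- r1^-1)%R) * x j
      r1^-1%R.
  by rewrite !pg_xD (y_pin_n _ _ r0) (y_pin_n _ _ r10) !mulgA.
rewrite (_ : _ + _ + _ = 0)%R; last by rewrite /r1; field; rewrite r0 rd0.
rewrite pg_x0 mulg1; apply: gen_M; last exact: x_B.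
apply: gen_M; first exact: x_B.
by apply: torus_B; apply: pin_nn_torus; rewrite oppr_eq0 invr_eq0.
Qed.

(* The unipotent radical of the parabolic subgroup of type [j]. *)
Definition radical (j : I) : set G := subgroup_gen
  [set g | exists i a e, i != j /\ g = x j e * x i a * x j (- e)%R].

(** On a generator with [i] and [j] commuting this is immediate. Otherwise the braid relation
    rewrites it as u x_j(d) w x_j(-d) with u, w in the root subgroup of i, which commutes with y_j;
    its conjugate is then u b w b^-1, where b is in B by [B_yx]. *)
Lemma radical_y j v r : radical j v -> B (y j r * v * y j (- r)%R).
Proof.
apply: (@gen_min _ [set v | B (y j r * v * y j (- r)%R)]); first split;
  rewrite /=.
- by rewrite mulg1 -pg_yD addrN pg_y0; apply: gen_1.
- move=> g h Bg Bh; have := gen_M Bg Bh.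
  by rewrite !mulgA -(mulgA _ (y j (- r)%R)) -pg_yD addNr pg_y0 mulg1.
- move=> g Bg; have := gen_V Bg.
  by rewrite !invMg -!pg_yN opprK mulgA.
move=> _ [i [a [e [ij ->]]]] /=.
have ynx (t u : F) : y j t * x i u = x i u * y j t.
  by have := pg_xy G u t ij; rewrite /commute => ->.
have [d0|d1] : dot s j i = 0 \/ dot s j i = (-1)%R.
  by rewrite /dot eq_sym (negPf ij); case: ifP; [right | left].
  have := @pg_xC _ _ _ _ G j i e a d0; rewrite /commute => ->.
  rewrite -(mulgA (x i a)) -pg_xD addrN pg_x0 mulg1 ynx -mulgA -pg_yD addrN
    pg_y0.
  by rewrite mulg1; apply: x_B.
(* The parameter [d] is free in the braid relation; it only has to avoid 0 and the pole of [B_yx],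
   so 1 or -1 will do. *)
have [d d0 rd0] : exists2 d : F, d != 0%R & (1 + r * d != 0)%R.
  have [r1|r1] := eqVneq (1 + r)%R 0%R.
    exists (-1)%R; first by rewrite oppr_eq0 oner_eq0.
    by apply/eqP => E; have := oner_neq0 F; move/eqP: r1 E => /eqP; lra.
  by exists 1%R; rewrite ?oner_eq0 ?mulr1.
have -> : x j e * x i a * x j (- e)%R =
    x i (a * (d - e) / d)%R * x j d * x i (e * a / d)%R * x j (- d)%R.
  rewrite -(pg_x_braid G (a := e) (b := a) (c := (d - e)%R) d1); try by field.
  by rewrite -(mulgA _ (x j (d - e)%R)) -pg_xD; congr (_ * x j _); ring.
set r' := (r / (1 + r * d))%R.
have Bb := B_yx j rd0; rewrite -/r' in Bb; set b := _ * y j (- r')%R in Bb.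
set u := x i _; set w := x i _.
suff -> : y j r * (u * x j d * w * x j (- d)%R) * y j (- r)%R = u * b * w *
  b^-1.
  by do 3?[apply: gen_M]; rewrite ?/u ?/w; try exact: x_B; try exact: gen_V.
rewrite /b !invMg -!pg_xN -!pg_yN opprK !mulgA ynx; congr (_ * _ * _).
by rewrite -!mulgA; do 3 congr (_ * _);
  rewrite mulgA ynx -mulgA -pg_yD addNr pg_y0 mulg1.
Qed.

Lemma radical_x j v e : radical j v -> radical j (x j e * v * x j (- e)%R).
Proof.
apply: (@gen_min _ [set v | radical j (x j e * v * x j (- e)%R)]); first split.
- by rewrite /= mulg1 -pg_xD addrN pg_x0; apply: gen_1.
- move=> g h Rg Rh; have := gen_M Rg Rh.
  by rewrite /= !mulgA -(mulgA _ (x j (- e)%R)) -pg_xD addNr pg_x0 mulg1.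
- move=> g Rg; have := gen_V Rg.
  by rewrite /= !invMg -!pg_xN opprK mulgA.
move=> _ [i [a [e' [ij ->]]]]; apply: gen_sub; exists i, a, (e + e')%R;
  split=> //.
by rewrite !mulgA -pg_xD -!mulgA -pg_xD addrC opprD.
Qed.

Lemma radical_torus j v h : T h -> radical j v -> radical j (h * v * h^-1).
Proof.
move=> Th; apply: (@gen_min _ [set v | radical j (h * v * h^-1)]); first split.
- by rewrite /= mulg1 mulgV; apply: gen_1.
- move=> g g' Rg Rg'; have := gen_M Rg Rg'.
  by rewrite /= !mulgA mulgVK.
- move=> g Rg; have := gen_V Rg; by rewrite /= !invMg invgK mulgA.
move=> _ [i [a [e [ij ->]]]] /=.
have [l _ lx] := torus_x j Th; have [l' _ lx'] := torus_x i Th.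
apply: gen_sub; exists i, (l' * a)%R, (l * e)%R; split=> //.
by rewrite -mulrN -!lx -lx' !mulgA !mulgVK.
Qed.

(** The torus and the root subgroup of [j] normalize the radical, so products of this shape are
    closed under multiplication and inversion, and they contain the generators of B. *)
Lemma borel_radical j b : B b ->
  exists v h e, [/\ radical j v, T h & b = v * h * x j e].
Proof.
apply: (@gen_min _ [set b | exists v h e,
  [/\ radical j v, T h & b = v * h * x j e]]); first split.
- by exists 1, 1, 0%R; rewrite pg_x0 !mulg1; split=> //; apply: gen_1.
- move=> _ _ [v [h [e [Rv Th ->]]]] [v' [h' [e' [Rv' Th' ->]]]].
  have ThV : T h'^-1 by apply: gen_V.
  have [l _ lx] := torus_x j ThV.
  exists (v * (h * (x j e * v' * x j (- e)%R) * h^-1)), (h * h'),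
    (l * e + e')%R.
  split; last by rewrite pg_xD -lx pg_xN invgK !mulgA !(mulgVK, mulgK).
    by apply: gen_M => //; apply: radical_torus => //; apply: radical_x.
  exact: gen_M.
- move=> _ [v [h [e [Rv Th ->]]]].
  have ThV : T h^-1 by apply: gen_V.
  have [l _ lx] := torus_x j Th.
  exists (x j (- e)%R * (h^-1 * v^-1 * h^-1^-1) * x j (- - e)%R), h^-1,
    (l * - e)%R.
  split=> //; last by rewrite -lx !invMg invgK opprK !pg_xN !mulgA !(mulgVK,
    mulgK).
  by apply: radical_x; apply: radical_torus => //; apply: gen_V.
move=> {}b [Tb|]; first by exists 1, b, 0%R; rewrite pg_x0 mulg1 mul1g;
  split=> //; apply: gen_1.
move=> Ub; pose A := [set b | exists v e, radical j v /\ b = v * x j e]%classic.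
suff [v [e [Rv ->]]] : A b by exists v, 1, e; rewrite mulg1; split=> //;
  apply: gen_1.
apply: (gen_min _ _ Ub); first split.
- by exists 1, 0%R; rewrite pg_x0 mulg1; split=> //; apply: gen_1.
- move=> _ _ [v [e [Rv ->]]] [v' [e' [Rv' ->]]].
  exists (v * (x j e * v' * x j (- e)%R)), (e + e')%R.
  split; last by rewrite pg_xD pg_xN !mulgA !mulgVK.
  by apply: gen_M => //; apply: radical_x.
- move=> _ [v [e [Rv ->]]]; exists (x j (- e)%R * v^-1 * x j (- - e)%R),
    (- e)%R.
  split; last by rewrite opprK invMg !pg_xN mulgK.
  by apply: radical_x; apply: gen_V.
move=> _ [i [a ->]]; have [->|ij] := eqVneq i j.
  by exists 1, a; rewrite mul1g; split=> //; apply: gen_1.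
exists (x i a), 0%R; rewrite pg_x0 mulg1; split=> //; apply: gen_sub.
by exists i, a, 0%R; rewrite oppr0 pg_x0 mul1g mulg1.
Qed.

(** The action of [b] on the line of cosets B y_j(r): since [l] and [e] do not depend on [r], it is
    given by a single Moebius transformation. *)
Lemma y_borel j b : B b -> exists l e, l != 0%R /\
  forall r, exists2 b', B b' & y j r * b = b' * (y j (l * r)%R * x j e).
Proof.
move=> Bb; have [v [h [e [Rv Th ->]]]] := borel_radical j Bb.
have ThV : T h^-1 by apply: gen_V.
have [l l0 ly] := torus_y j ThV; exists l, e; split=> // r.
exists (y j r * v * y j (- r)%R * h).
  by apply: gen_M; [apply: radical_y | apply: torus_B].
by rewrite -ly invgK pg_yN !mulgA !(mulgVK, mulgK).
Qed.

Definition xprod (w : seq (I * F)) : G := \prod_(p <- w) x p.1 p.2.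
Definition yprod (w : seq (I * F)) : G := \prod_(p <- w) y p.1 p.2.

Lemma yprod_cell w : exists2 v, cell v (yprod w) & (len v <= size w)%N.
Proof.
rewrite /yprod; elim: w => [|[i a] w [v Cv lv]].
  by exists 1; rewrite ?big_nil ?(coxlen1 s) //; apply/cell1; apply: gen_1.
rewrite big_cons /=; have [->|a0] := eqVneq a 0%R.
  by exists v; rewrite ?pg_y0 ?mul1g // (leq_trans lv).
case: (cell_sM (cell_y G i a0) Cv) => C; first by exists v => //;
  apply: leq_trans lv _.
by exists (s i * v) => //; have := coxlen_sM cox i v; lia.
Qed.

Lemma yprod_reduced w : reduced s (unzip1 w) -> all (fun p => p.2 != 0%R) w ->
  cell (wprod s (unzip1 w)) (yprod w).
Proof.
rewrite /yprod; elim: w => [|[i a] w IH] /=.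
  by rewrite wprod_nil big_nil => _ _; apply/cell1; apply: gen_1.
move=> /(reduced_cons cox) [red longer] /andP [a0 w0].
by rewrite wprod_cons big_cons; apply: cell_longer => //;
  [apply: cell_y | apply: IH].
Qed.

(** If the first parameters differed, bringing both to one side would place the remaining product in
    the cell of its own word and in the cell lengthened by [s i]. *)
Lemma yprod_inj w w' : unzip1 w = unzip1 w' -> reduced s (unzip1 w) ->
  all (fun p => 0 < p.2)%R w -> all (fun p => 0 < p.2)%R w' ->
  yprod w = yprod w' -> w = w'.
Proof.
elim: w w' => [|[i a] w IH] [|[i' a'] w'] //= [<- ww'].
move=> /(reduced_cons cox) [red longer] /andP [a0 wpos] /andP [a'0 wpos'].
have key (b b' : F) v v' : unzip1 v = unzip1 w -> unzip1 v' = unzip1 w ->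
    all (fun p => 0 < p.2)%R v -> all (fun p => 0 < p.2)%R v' -> (b < b')%R ->
    y i b * yprod v = y i b' * yprod v' -> False.
  move=> vw vw' vpos vpos' bb' E.
  have neq0 u : all (fun p => 0 < p.2)%R u ->
    all (fun p : I * F => p.2 != 0%R) u.
    by apply: sub_all => p; apply: lt0r_neq0.
  have := yprod_reduced (w := v); rewrite vw => /(_ red (neq0 _ vpos)) Cv.
  have := yprod_reduced (w := v'); rewrite vw' => /(_ red (neq0 _ vpos')) Cv'.
  have Ev : yprod v = y i (b' - b)%R * yprod v'.
    by apply: (mulgI (y i b)); rewrite E mulgA -pg_yD addrC subrK.
  have := cell_longer cox longer (cell_y G i (a := (b' - b)%R) _) Cv'.
  rewrite subr_eq0 gt_eqF // -Ev => /(_ isT) /(cell_disjoint cox Cv) E'.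
  by move: longer; rewrite -E' => /n_Sn.
rewrite /yprod !big_cons -/(yprod w) -/(yprod w') /= => E.
have [lt|lt|aa'] := ltgtP a a'.
- by case: (key a a' w w').
- by case: (key a' a w' w).
by move: E; rewrite -aa' => /mulgI /(IH _ ww' red wpos wpos') ->.
Qed.

End ParabolicRadical.

(** * The longest element exchanges the Borel subgroups; the two parametrizations of a half
    circle *)

Section OppositeHalfCircles.
Local Open Scope group_scope.
Variables (F : realFieldType) (I : finType) (gT : finGroupType) (s : I -> gT).
Variable G : pinned_group F s.
Hypothesis cox : coxeter_system s.
Hypothesis simply_laced :
  forall i j, i != j -> #[s i * s j]%g = 2%N \/ #[s i * s j]%g = 3%N.

Local Notation x := (@pg_x _ _ _ _ G).
Local Notation y := (@pg_y _ _ _ _ G).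
Local Notation T := (torus x y).
Local Notation N := (torus_normalizer x y).
Local Notation B := (borel x y x).
Local Notation Bm := (borel x y y).
Local Notation weyl := (@pg_weyl _ _ _ _ G).
Local Notation len := (coxlen s).
Local Notation cell := (@cell _ _ _ _ G).
Local Notation xprod := (@xprod _ _ _ _ G).
Local Notation yprod := (@yprod _ _ _ _ G).
Let exch := @exchange _ _ _ _ G cox.
Let bangK := bangK cox simply_laced exch.

Lemma conj_subgroup (H : groupType) (A : set H) m :
  is_subgroup A -> is_subgroup [set g | A (m * g * m^-1)].
Proof.
move=> [A1 AM AV]; split=> /= [|g h Ag Ah|g Ag]; first by rewrite mulg1 mulgV.
  by have := AM _ _ Ag Ah; rewrite !mulgA mulgVK.
by have := AV _ Ag; rewrite !invMg invgK mulgA.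
Qed.

Lemma conj_set_comp (H : groupType) (A : set H) u m :
  conj_set u (conj_set m A) = conj_set (m * u) A.
Proof.
rewrite /conj_set image_comp; apply: eq_imagel => g _ /=.
by rewrite invMg !mulgA.
Qed.

Lemma conj_borel b g : B b -> conj_set (b * g) B = conj_set g B.
Proof.
move=> Bb; have sub (b' g' : G) : B b' ->
  (conj_set (b' * g') B `<=` conj_set g' B)%classic.
  move=> Bb' _ [c Bc <-]; exists (b'^-1 * c * b'); last by rewrite invMg !mulgA.
  by apply: gen_M => //; apply: gen_M => //; apply: gen_V.
apply/seteqP; split; first exact: sub.
by rewrite -{1}(mulKg b g); apply: sub; apply: gen_V.
Qed.

Lemma long_conj_x m i : N m -> weyl m = w0 s ->
  exists2 c, c != 0%R & forall a, m * x i a * m^-1 = y (bang s i) (c * a)%R.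
Proof.
by move=> Nm mE; have [c c0 E] := pg_w0 (bang s i) Nm mE; exists c => // a;
  rewrite -E bangK.
Qed.

Lemma weylV_long m : N m -> weyl m = w0 s -> weyl m^-1 = w0 s.
Proof. by move=> Nm mE; rewrite weylV // mE (w0V cox exch). Qed.

Lemma long_conj_opposite m g : N m -> weyl m = w0 s -> Bm g -> B (m * g * m^-1).
Proof.
move=> Nm mE; apply: (@gen_min _ [set g | B (m * g * m^-1)]).
  exact/conj_subgroup/gen_subgroup.
move=> {}g [Tg|]; first by apply: torus_B; apply: torus_conj.
apply: gen_min; first exact/conj_subgroup/gen_subgroup.
have NV : N m^-1 by apply: gen_V.
move=> _ [i [a ->]] /=.
have [c c0 E] := long_conj_x (bang s i) NV (weylV_long Nm mE).
rewrite bangK invgK in E; rewrite -[a](mulVKf c0) -E !mulgA mulgV mul1g mulgK.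
exact: x_B.
Qed.

Lemma long_conj_borel m g : N m -> weyl m = w0 s -> B g -> Bm (m * g * m^-1).
Proof.
move=> Nm mE; apply: (@gen_min _ [set g | Bm (m * g * m^-1)]).
  exact/conj_subgroup/gen_subgroup.
move=> {}g [Tg|]; first by apply: gen_sub; left; apply: torus_conj.
apply: gen_min; first exact/conj_subgroup/gen_subgroup.
move=> _ [i [a ->]] /=; have [c c0 ->] := long_conj_x i Nm mE.
by apply: gen_sub; right; apply: gen_sub; eexists; eexists.
Qed.

(** This writes the flags defined from [Bm] as conjugates of [B], so that [borel_normalizer] can
    compare them. *)
Lemma opposite_borel m : N m -> weyl m = w0 s -> conj_set m B = Bm.
Proof.
move=> Nm mE; have NV : N m^-1 by apply: gen_V.
apply/seteqP; split=> [_ [b Bb <-] | g Bg].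
  by have := long_conj_borel NV (weylV_long Nm mE) Bb; rewrite invgK.
exists (m * g * m^-1); first exact: long_conj_opposite.
by rewrite !mulgA mulVg mul1g mulgVK.
Qed.

Lemma yprod_unip w : unip y (yprod w).
Proof.
elim: w => [|[i a] w IH]; rewrite /yprod; first by rewrite big_nil;
  apply: gen_1.
by rewrite big_cons; apply: gen_M => //; apply: gen_sub; exists i, a.
Qed.

Lemma yprod_opposite w : Bm (yprod w).
Proof. by apply: gen_sub; right; apply: yprod_unip. Qed.

Lemma xprod_borel w : B (xprod w).
Proof.
rewrite /xprod; elim: w => [|[i a] w IH]; first by rewrite big_nil;
  apply: gen_1.
by rewrite big_cons; apply: gen_M => //; apply: x_B.
Qed.

Lemma long_conj_xprod m w : N m -> weyl m = w0 s ->
  exists2 w', size w' = size w & m * xprod w * m^-1 = yprod w'.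
Proof.
move=> Nm mE; rewrite /xprod /yprod; elim: w => [|[i a] w [w' sz E]].
  by exists [::]; rewrite // !big_nil mulg1 mulgV.
have [c _ cE] := long_conj_x i Nm mE.
exists ((bang s i, c * a)%R :: w'); first by rewrite /= sz.
by rewrite !big_cons -E -cE !mulgA mulgVK.
Qed.

Lemma yprod_not_long w : (size w < nu s)%N -> ~ cell (w0 s) (yprod w).
Proof.
have [v Cv lv] := yprod_cell G cox w => lt_w /(cell_disjoint cox Cv) vE.
by have := leq_ltn_trans lv lt_w; rewrite vE ltnn.
Qed.

(* Both families run through the flags of a line other than the two end points
   [xprod w2] and [yprod w3], so that the parameters are related by a Moebius
   transformation exchanging [0] and infinity. *)
Lemma opposite_half_circle j (a b t : F) w2 w3 :
  (size w2 < nu s)%N -> (size w3 < nu s)%N ->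
  a != 0%R -> b != 0%R -> t != 0%R ->
  conj_set (x j a * xprod w2) Bm = conj_set (y (bang s j) b * yprod w3) B ->
  conj_set (x j t * xprod w2) Bm =
    conj_set (y (bang s j) (b * a / t)%R * yprod w3) B.
Proof.
move=> sz2 sz3 a0 b0 t0; set j' := bang s j.
have [m Nm mE] := weyl_onto G cox (w0 s).
rewrite -(opposite_borel Nm mE) !conj_set_comp => /(borel_normalizer cox).
set beta := _ * _ => Bbeta.
have [c c0 cE] := long_conj_x j Nm mE; rewrite -/j' in cE.
have [l [e [l0 lE]]] := y_borel j' Bbeta.
(* Conjugation by [m] turns x_j(u - a) into y_j'(c (u - a)), and moving [beta] across it multiplies
   the parameter by [l]. *)
pose sg u := (l * (c * (u - a)))%R.
(* The factor x_j'(e) produced by [beta] is absorbed with [B_yx], away from the pole. The parameter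
   of y_j' becomes a Moebius function of [u] with value [b] at [u = a]. *)
have move_x u : (1 + sg u * e != 0)%R -> exists2 b', B b' &
    m * (x j u * xprod w2) = b' * (y j' (sg u / (1 + sg u * e) + b)%R * yprod
      w3).
  move=> pole; have [b' Bb' b'E] := lE (c * (u - a))%R.
  have := @B_yx _ _ _ s G j' _ _ pole; rewrite pg_yN;
    set b'' := _ * _^-1 => Bb''.
  exists (b' * b''); first exact: gen_M.
  have -> : m * (x j u * xprod w2) =
      y j' (c * (u - a))%R * (beta * (y j' b * yprod w3)).
    rewrite -cE /beta mulgVK !mulgA mulgVK -(mulgA m (x j (u - a)%R)) -pg_xD.
    by rewrite subrK.
  by rewrite mulgA b'E /b'' pg_yD !mulgA mulgVK.
(* The pole is at [u = 0]: otherwise the conjugate of [xprod w2] by [m], a product of fewer than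
   [nu] factors [y], would lie in the cell of [w0]. *)
have e1 : (l * c * a * e = 1)%R.
  apply/eqP/negPn/negP => ne1.
  have pole : (1 + sg 0 * e != 0)%R.
    have -> : (1 + sg 0 * e = 1 - l * c * a * e)%R by rewrite /sg; ring.
    by rewrite subr_eq0 eq_sym.
  have [b' Bb'] := move_x 0%R pole; rewrite pg_x0 mul1g;
    set g := _ * yprod w3 => E.
  have Bg : B (m * g * m^-1).
    apply: long_conj_opposite => //; apply: gen_M; last exact: yprod_opposite.
    by apply: gen_sub; right; apply: gen_sub; eexists; eexists.
  have [w' sz E'] := long_conj_xprod w2 Nm mE.
  apply: (@yprod_not_long w'); rewrite ?sz // -E' E.
  have -> : b' * g * m^-1 = b' * m^-1 * (m * g * m^-1) by rewrite !mulgA mulgVK.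
  apply: cell_rmul => //; apply: cell_lmul => //.
  by rewrite -(weylV_long Nm mE); apply: cell_N; apply: gen_V.
have e0 : e != 0%R by apply: contra_eq_neq e1 => ->;
  rewrite mulr0 eq_sym oner_eq0.
have sgE u : (sg u = (u - a) / (e * a))%R.
  apply: (mulIf e0); apply: (mulIf a0); rewrite /sg.
  have -> : (l * (c * (u - a)) * e * a = l * c * a * e * (u - a))%R by ring.
  by rewrite e1; field; rewrite e0 a0.
have poleE u : (1 + sg u * e = u / a)%R by rewrite sgE; field; rewrite e0 a0.
have pole u : u != 0%R -> (1 + sg u * e != 0)%R.
  by move=> u0; rewrite poleE mulf_neq0 ?invr_eq0.
have fracE u : u != 0%R -> (sg u / (1 + sg u * e) = (u - a) / (e * u))%R.
  by move=> u0; rewrite poleE sgE; field; rewrite e0 a0 u0.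
(* The zero is at infinity: otherwise the parameter of y_j' would vanish at [a / (1 + b * e)],
   placing [yprod w3] in the cell of [w0]. *)
have e2 : (1 + b * e = 0)%R.
  apply/eqP/negPn/negP => ne2; pose u := (a / (1 + b * e))%R.
  have u0 : u != 0%R by rewrite mulf_neq0 ?invr_eq0.
  have [b' Bb'] := move_x u (pole u u0).
  have -> : (sg u / (1 + sg u * e) + b = 0)%R.
    by rewrite fracE // /u; field; rewrite ne2 e0 a0.
  rewrite pg_y0 mul1g => E; apply: (@yprod_not_long w3) => //.
  have -> : yprod w3 = b'^-1 * m * (x j u * xprod w2) by rewrite -mulgA E mulKg.
  apply: cell_rmul; first by apply: gen_M; [exact: x_B | exact: xprod_borel].
  by apply: cell_lmul; [exact: gen_V | rewrite -mE; apply: cell_N].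
have [b' Bb' ->] := move_x t (pole t t0).
rewrite conj_borel //; congr (conj_set (y j' _ * _) _).
have eE : (e = - b^-1)%R.
  by apply: (mulfI b0); rewrite mulrN divff //; apply/eqP;
    rewrite -subr_eq0 opprK addrC e2.
by rewrite fracE // eE; field; rewrite ?t0 ?b0 ?oppr_eq0 ?oner_eq0 /=.
Qed.

End OppositeHalfCircles.

Section ScaleFirst.
Local Open Scope ring_scope.
Variables (I : finType) (K : semifield).

Lemma scale_first_word n (i : n.-tuple I) (a : 'I_n ->
  K) j : ohead i = Some j ->
  exists a0 w, [/\ size w = n.-1,
    [seq (tnth i l, a l) | l <- enum 'I_n] = (j, a0) :: w &
    forall c, [seq (tnth i l, scale_first c a l) | l <- enum 'I_n] =
      (j, sf_mul a0 c) :: w].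
Proof.
case: n i a => [|n] i a; first by rewrite tuple0.
case/tupleP: i => i0 i /= [i0j]; exists (a ord0).
exists [seq (tnth [tuple of i0 :: i] (lift ord0 l),
  a (lift ord0 l)) | l <- enum 'I_n].
split=> [||c]; first by rewrite size_map size_enum_ord.
  by rewrite enum_ordSl /= -map_comp -i0j.
by rewrite enum_ordSl /= -map_comp -i0j.
Qed.

(** The scalar [c] is made an additional last variable, so that both sides become expressions in
    [n.+1] variables and [sfeval_transfer] applies. *)
Lemma scale_first_transfer (Re k : realFieldType) n (Q : 'I_n -> sfexpr n) :
  (forall (c : pos_semifield Re) a l, sfeval (scale_first c a) (Q l) =
     scale_first (sf_inv c) (fun m => sfeval a (Q m)) l) ->
  forall (c : pos_semifield k) a l, sfeval (scale_first c a) (Q l) =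
     scale_first (sf_inv c) (fun m => sfeval a (Q m)) l.
Proof.
move=> real_eq c a l.
pose v (m : 'I_n) : sfexpr n.+1 := SfVar (lift ord_max m).
pose e1 := sfsubst (fun m : 'I_n =>
  if m == 0%N :> nat then SfMul (v m) (SfVar ord_max) else v m) (Q l).
pose e2 := if l == 0%N :> nat
  then SfMul (sfsubst v (Q l)) (SfInv (SfVar ord_max)) else sfsubst v (Q l).
have eval1 (K' : semifield) (b : 'I_n.+1 -> K') :
    sfeval b e1 = sfeval (scale_first (b ord_max) (fun m =>
      b (lift ord_max m))) (Q l).
  by rewrite sfeval_subst; apply: eq_sfeval => m; rewrite /scale_first;
    case: ifP.
have eval2 (K' : semifield) (b : 'I_n.+1 -> K') : sfeval b e2 =
    scale_first (sf_inv (b ord_max)) (fun m => sfeval (fun m =>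
      b (lift ord_max m)) (Q m)) l.
  by rewrite /e2 /scale_first; case: ifP => _ /=; rewrite sfeval_subst.
pose b (m : 'I_n.+1) := if unlift ord_max m is Some m' then a m' else c.
have bE : (fun m : 'I_n => b (lift ord_max m)) = a.
  by apply: funext => m; rewrite /b liftK.
have bc : b ord_max = c by rewrite /b unlift_none.
rewrite -bE -bc -eval1 -eval2; apply: (@sfeval_transfer Re) => b'.
by rewrite eval1 eval2 real_eq.
Qed.

End ScaleFirst.

(** * The involution carries half circles to half circles *)

Section PhiOfHalfCircle.
Local Open Scope ring_scope.
Variables (I : finType) (gT : finGroupType) (s : I -> gT).
Variables (k : realFieldType) (Re : realType) (G : pinned_group Re s).
Hypothesis cox : coxeter_system s.
Hypothesis simply_laced :
  forall i j, i != j -> #[s i * s j]%g = 2%N \/ #[s i * s j]%g = 3%N.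
Local Notation nu := (nu s).
Let exch := @exchange _ _ _ _ G cox.

Lemma red_word_tuple r : wprod s r = w0 s -> size r = nu ->
  exists2 i : nu.-tuple I, red_words i & i = r :> seq I.
Proof.
move=> rE /eqP size_r; exists (Tuple size_r) => //.
by apply/red_wordsP.
Qed.

Lemma red_word_head j : exists2 i : nu.-tuple I, red_words i & ohead i = Some j.
Proof.
have [r rE size_r] := reduced_word cox (s j * w0 s)%g.
have [||i red iE] := @red_word_tuple (j :: r).
- by rewrite wprod_cons rE mulgA (s_sqr cox) mul1g.
- rewrite /= size_r; have := nu_max s (s j * w0 s)%g.
  by have := coxlen_sM cox j (w0 s); rewrite /nu; lia.
by exists i => //; rewrite iE.
Qed.

Lemma red_word_last j : exists2 i : nu.-tuple I, red_words i &
  exists r, i = rcons r j :> seq I.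
Proof.
have [r rE size_r] := reduced_word cox (w0 s * s j)%g.
have [||i red iE] := @red_word_tuple (rcons r j).
- by rewrite wprod_rcons rE -mulgA (s_sqr cox) mulg1.
- rewrite size_rcons size_r; have := nu_max s (w0 s * s j)%g.
  by have := coxlen_Ms cox j (w0 s); rewrite /nu; lia.
by exists i => //; exists r.
Qed.

Lemma calU_head (K : semifield) (H : fU s K) j : calU H ->
  exists i (a : 'I_nu -> K), [/\ red_words i,
    ohead i = Some j & H = fcoord i a].
Proof.
move=> [i0 [red0 [a0 ->]]]; have [i red ij] := red_word_head j.
have [R [RK _ _]] := change_word cox simply_laced exch red0 red.
by exists i; eexists; split=> //; apply: RK.
Qed.

Local Notation posw i a := [seq (p.1, pos_val p.2) | p <- [seq (tnth i l,
  a l) | l <- enum 'I_nu]].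

Lemma xcoordE i (a : 'I_nu -> pos Re) : xcoord G i a = xprod G (posw i a).
Proof. by rewrite /xcoord /xprod 2!big_map big_enum_ord. Qed.

Lemma ycoordE i (a : 'I_nu -> pos Re) : ycoord G i a = yprod G (posw i a).
Proof. by rewrite /ycoord /yprod 2!big_map big_enum_ord. Qed.

(** As B is self-normalizing, the quotient of the two unipotent elements lies in B and in the
    opposite unipotent subgroup, hence is 1 by [pg_opp_y]; then [yprod_inj] applies. *)
Lemma ycoord_flag_inj i (a b : 'I_nu -> pos Re) : red_words i ->
  conj_set (ycoord G i a) (@Bplus _ _ _ _ G) = conj_set (ycoord G i b) (@Bplus _
    _ _ _ G) -> a =1 b.
Proof.
move=> red /(borel_normalizer cox) Bab.
have : (@Bplus _ _ _ _ G `&` unip (@pg_y _ _ _ _ G))%classic (ycoord G i a *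
  (ycoord G i b)^-1)%g.
  by split=> //; rewrite !ycoordE; apply: gen_M; [|apply: gen_V];
    apply: yprod_unip.
rewrite /Bplus pg_opp_y => /= ab1.
have : ycoord G i a = ycoord G i b.
  by apply: (mulIg (ycoord G i b)^-1%g); rewrite ab1 mulgV.
have unzipE c : unzip1 (posw i c) = i.
  by rewrite /unzip1 -2!map_comp; apply: map_tnth_enum.
have pos_all c : all (fun p => 0 < p.2) (posw i c).
  by apply/allP => _ /mapP [_ /mapP [l _ ->] ->]; apply: pos_valP.
rewrite !ycoordE => /(yprod_inj cox) ; rewrite !unzipE.
move=> /(_ (erefl _) (red_words_reduced red) (pos_all _ a) (pos_all _ b)) E.
have {E} /eq_in_map E : [seq (tnth i l, a l) | l <- enum 'I_nu] =
    [seq (tnth i l, b l) | l <- enum 'I_nu].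
  by apply: inj_map E => -[u1 u2] [v1 v2] /= [-> uv]; congr (_, _);
    apply: val_inj.
move=> l; have l_enum : l \in enum 'I_nu by rewrite mem_enum.
by case: (E l l_enum).
Qed.

Lemma half_circle_real j (i i' : nu.-tuple I) (a b : 'I_nu ->
  pos_semifield Re) c :
  ohead i = Some j -> ohead i' = Some (bang s j) ->
  conj_set (xcoord G i a) (@Bminus _ _ _ _ G) = conj_set (ycoord G i' b) (@Bplus
    _ _ _ _ G) ->
  conj_set (xcoord G i (scale_first c a)) (@Bminus _ _ _ _ G) =
    conj_set (ycoord G i' (scale_first (sf_inv c) b)) (@Bplus _ _ _ _ G).
Proof.
move=> ij ij'; rewrite !xcoordE !ycoordE.
have [a0 [w2 [sz2 -> ->]]] := scale_first_word a ij.
have [b0 [w3 [sz3 -> ->]]] := scale_first_word b ij'.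
rewrite /xprod /yprod !map_cons !big_cons -/(xprod G _) -/(yprod G _) => E.
have nu0 : (0 < nu)%N.
  by rewrite -(size_tuple i); case: (tval i) ij.
(* With [t = a0 * c] the parameter [b0 * a0 / t] is [b0 / c]. *)
have -> : pos_val (sf_mul b0 (sf_inv c)) =
    pos_val b0 * pos_val a0 / pos_val (sf_mul a0 c).
  by rewrite /=; field; rewrite !lt0r_neq0 ?pos_valP.
apply: (opposite_half_circle cox simply_laced) E;
  rewrite ?size_map ?sz2 ?sz3 ?prednK //; exact/lt0r_neq0/pos_valP.
Qed.

(** With [H] written along a word starting with [j] and its image along one starting with
    [bang s j], the claim is an identity between the expressions [Q]. Over [Re] it follows from the
    geometry of flags, and it is then transferred to [k]. *)
Lemma phi_half_circle T phi j c (H : fU s (pos_semifield k)) :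
  is_T T -> is_phi G phi -> calU H ->
  phi (T j c H) = T (bang s j) (sf_inv c) (phi H).
Proof.
move=> isT isphi /(calU_head j) [i [a [red ij ->]]].
have [i' red' ij'] := red_word_head (bang s j).
have [P [realP kP]] := isphi i red.
have [R [RK _ RG]] := change_word cox simply_laced exch red red'.
pose Q l := sfsubst P (R l).
have phiE b : phi (fcoord i b) = fcoord i' (fun l => sfeval b (Q l)).
  rewrite kP RK; congr fcoord; apply: funext => l; by rewrite sfeval_subst.
rewrite isT // !phiE isT //; congr fcoord; apply: funext => l.
apply: (@scale_first_transfer Re) => {a l} {}c a l.
have realQ (b : 'I_nu -> pos_semifield Re) : conj_set (xcoord G i b) (@Bminus _
  _ _ _ G) =
    conj_set (ycoord G i' (fun l => sfeval b (Q l))) (@Bplus _ _ _ _ G).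
  rewrite realP RG; congr (conj_set (ycoord _ _ _) _).
  by apply: funext => m; rewrite sfeval_subst.
apply: (@ycoord_flag_inj i' (fun m => sfeval (scale_first c a) (Q m))
  (scale_first (sf_inv c) (fun m => sfeval a (Q m)))) => //.
by rewrite -realQ; apply: (half_circle_real _ ij ij').
Qed.

End PhiOfHalfCircle.

(** * Common left multiples *)

Section Bounds.
Local Open Scope ring_scope.
Variables (k : realFieldType).
Local Notation K := (pos_semifield k).

(** Without subtraction, each operation maps intervals with positive end points to such
    intervals. *)
Lemma sfeval_bounds n (e : sfexpr n) (d D : k) : 0 < d <= D ->
  exists d' D', 0 < d' <= D' /\ forall a : 'I_n -> K,
    (forall l, d <= pos_val (a l) <= D) -> d' <= pos_val (sfeval a e) <= D'.
Proof.
move=> dD; elim: e => [l | | e1 [d1 [D1 [/andP [p1 q1] E1]]] e2 [d2 [D2 [/andP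
  [p2 q2] E2]]]
  | e1 [d1 [D1 [/andP [p1 q1] E1]]] e2 [d2 [D2 [/andP [p2 q2] E2]]]
  | e1 [d1 [D1 [/andP [p1 q1] E1]]]] /=.
- by exists d, D; split=> // a; apply.
- by exists 1, 1; split=> [|a _]; rewrite ?lexx ?ltr01.
- exists (d1 + d2), (D1 + D2); split=> [|a aP];
    first by rewrite addr_gt0 // lerD.
  by have /andP [? ?] := E1 a aP; have /andP [? ?] := E2 a aP; rewrite !lerD.
- exists (d1 * d2), (D1 * D2); split=> [|a aP].
    by rewrite mulr_gt0 // ler_pM // ltW.
  have /andP [? ?] := E1 a aP; have /andP [? ?] := E2 a aP.
  by apply/andP; split; apply: ler_pM => //; apply: ltW => //; apply: pos_valP.
- have D1_gt0 := lt_le_trans p1 q1.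
  exists D1^-1, d1^-1; split=> [|a aP];
    first by rewrite invr_gt0 D1_gt0 lef_pV2.
  have /andP [lo hi] := E1 a aP.
  by rewrite !lef_pV2 ?posrE ?pos_valP // hi lo.
Qed.

Lemma sfeval_bounds_tuple n m (R : 'I_m -> sfexpr n) (d D : k) : 0 < d <= D ->
  exists d' D', 0 < d' <= D' /\ forall a : 'I_n -> K,
    (forall l, d <= pos_val (a l) <= D) ->
    forall l, d' <= pos_val (sfeval a (R l)) <= D'.
Proof.
move=> dD; suff part q : exists d' D', 0 < d' <= D' /\ forall a : 'I_n -> K,
    (forall l, d <= pos_val (a l) <= D) ->
    forall l : 'I_m, (l < q)%N -> d' <= pos_val (sfeval a (R l)) <= D'.
  by have [d' [D' [? E]]] := part m; exists d', D'; split=> // a aP l; apply: E.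
elim: q => [|q [d1 [D1 [/andP [p1 q1] E1]]]].
  by exists 1, 1; split; rewrite ?lexx ?ltr01.
have [q_m | m_q] := ltnP q m; last first.
  exists d1, D1; split=> [|a aP l _]; first by rewrite p1.
  by apply: E1 => //; apply: leq_trans (ltn_ord l) m_q.
have [d2 [D2 [/andP [p2 q2] E2]]] := sfeval_bounds (R (Ordinal q_m)) dD.
exists (Num.min d1 d2), (Num.max D1 D2); split=> [|a aP l].
  by rewrite lt_min p1 p2 ge_min le_max q1.
rewrite ltnS leq_eqVlt => /orP [/eqP lq | lq].
  have -> : l = Ordinal q_m by apply: val_inj.
  by have /andP [u v] := E2 a aP; rewrite ge_min le_max u v !orbT.
by have /andP [u v] := E1 a aP l lq; rewrite ge_min le_max u v.
Qed.

End Bounds.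

Section LastCoordinate.
Local Open Scope ring_scope.
Variables (I : finType) (K : semifield).

Definition set_coord n (a : 'I_n -> K) (m : 'I_n) (t : K) : 'I_n -> K :=
  fun l => if l == m then t else a l.

Lemma last_word n (i : n.-tuple I) j r : i = rcons r j :> seq I ->
  exists m : 'I_n, forall a : 'I_n -> K, exists w,
    [seq (tnth i l, a l) | l <- enum 'I_n] = rcons w (j, a m) /\
    forall t, [seq (tnth i l, set_coord a m t l) | l <- enum 'I_n] =
      rcons w (j, t).
Proof.
case: n i => [|n] i ir.
  by have := congr1 size ir; rewrite size_tuple size_rcons.
have ij : tnth i ord_max = j.
  rewrite (tnth_nth j) ir nth_rcons /=.
  have := congr1 size ir; rewrite size_tuple size_rcons => -[->].
  by rewrite ltnn eqxx.
exists ord_max => a.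
exists [seq (tnth i l, a l) | l <- [seq widen_ord (leqnSn n) l | l <- enum
  'I_n]].
rewrite enum_ordSr !map_rcons ij; split=> // t.
rewrite map_rcons ij /set_coord eqxx; congr rcons.
rewrite -!map_comp; apply: eq_map => l /=; case: eqP => // /(congr1 val) /= E.
by have := ltn_ord l; rewrite E ltnn.
Qed.

End LastCoordinate.

(** * The left Ore condition, by estimates uniform in a large scale [L] *)

Section LeftOre.
Local Open Scope ring_scope.
Variables (I : finType) (gT : finGroupType) (s : I -> gT) (k : realFieldType).
Local Notation K := (pos_semifield k).
Local Notation nu := (nu s).
Local Notation fU := (fU s K).
Hypothesis change : forall i i' : nu.-tuple I, red_words i -> red_words i' ->
  exists R : 'I_nu -> sfexpr nu,
  (forall a : 'I_nu -> K, fcoord i a = fcoord i' (fun l => sfeval a (R l))) /\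
  forall (c : K) (a : 'I_nu -> K) l,
        sfeval (fun m => sf_mul c (a m)) (R l) = sf_mul c (sfeval a (R l)).
Hypothesis last_letter : forall j, exists2 i : nu.-tuple I, red_words i &
  exists r, i = rcons r j :> seq I.

(** Used with bounds [d * L] and [D * L], where [d] and [D] stay fixed as [L] grows. *)
Definition in_box (i : nu.-tuple I) (d D : k) (H : fU) : Prop :=
  exists2 a : 'I_nu -> K, H = fcoord i a & forall l, d <= pos_val (a l) <= D.

(** Dividing the coordinates by [L] reduces to bounds independent of [L]; homogeneity of [R]
    restores the scale. *)
Lemma box_change i i' (d D : k) : red_words i -> red_words i' -> 0 < d <= D ->
  exists d' D', 0 < d' <= D' /\ forall L H, 0 < L ->
    in_box i (d * L) (D * L) H -> in_box i' (d' * L) (D' * L) H.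
Proof.
move=> red red' dD; have [R [RE homR]] := change red red'.
have [d' [D' [dD' E]]] := sfeval_bounds_tuple R dD.
exists d', D'; split=> // L H L0 [a -> aP].
pose L' : K := Pos L0; pose b l : K := sf_mul (sf_inv L') (a l).
exists (fun l => sfeval a (R l)) => [|l]; first exact: RE.
have -> : sfeval a (R l) = sf_mul L' (sfeval b (R l)).
  rewrite -homR; apply: eq_sfeval => m.
  by rewrite /b sf_mulA sf_mulrV sf_mul1.
have bP m : d <= pos_val (b m) <= D.
  by rewrite /= mulrC ler_pdivlMr ?ler_pdivrMr ?aP.
by rewrite /= !(mulrC _ L) !ler_pM2l // E.
Qed.

Lemma gen_gen j (a b : K) :
  (fU_gen s j a * fU_gen s j b = fU_gen s j (sf_add a b))%g.
Proof.
rewrite [LHS](fU_mulE s [:: (j, a)] [:: (j, b)]).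
by apply/fU_eqP; apply: CongRel; apply: WordAdd.
Qed.

Lemma pi_cons j (a : K) w :
  \pi_fU%qT ((j, a) :: w) = (fU_gen s j a * \pi_fU%qT w)%g.
Proof. by symmetry; apply: (fU_mulE s [:: (j, a)]). Qed.

Lemma pi_rcons j (a : K) w :
  \pi_fU%qT (rcons w (j, a)) = (\pi_fU%qT w * fU_gen s j a)%g.
Proof. by rewrite -cats1; symmetry; apply: (fU_mulE s w [:: (j, a)]). Qed.

Lemma box_mul i0 w (d D : k) : red_words i0 -> 0 < d <= D ->
  exists d' D' L0, 0 < d' <= D' /\ forall L H, 0 < L -> L0 <= L ->
    in_box i0 (d * L) (D * L) H ->
    in_box i0 (d' * L) (D' * L) (H * \pi_fU%qT w)%g.
Proof.
move=> red0; elim: w d D => [|[j t] w IH] d D dD.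
  exists d, D, 0; split=> // L H _ _.
  by have -> : (H * \pi_fU%qT [::] = H)%g by apply: fU_mulr1.
have [i red [r ir]] := last_letter j.
have [d1 [D1 [/andP [d1_gt0 dD1] box1]]] := box_change red0 red dD.
(* The letter is absorbed into the last coordinate along a word ending in [j]; as [t <= L], that
   coordinate grows by at most [L]. *)
have dD1' : 0 < d1 <= D1 + 1 by rewrite d1_gt0 ler_wpDr // ler01.
have [d2 [D2 [dD2 box2]]] := box_change red red0 dD1'.
have [d3 [D3 [L0 [dD3 box3]]]] := IH _ _ dD2.
exists d3, D3, (Num.max L0 (pos_val t)); split=> // L H L_gt0.
rewrite ge_max => /andP [L0L tL] /(box1 _ _ L_gt0) [a -> aP].
rewrite pi_cons mulgA; apply: box3 => //; apply: box2 => //.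
have [m /(_ a) [u [uE setE]]] := last_word K ir.
exists (set_coord a m (sf_add (a m) t)).
  by rewrite !fcoordE uE setE !pi_rcons -mulgA gen_gen.
move=> l; rewrite /set_coord; have /andP [lo hi] := aP l.
case: eqP => [<- | _] /=; rewrite mulrDl mul1r.
  by rewrite lerD // ler_wpDr // ltW // pos_valP.
by rewrite lo ler_wpDr // ltW.
Qed.

Lemma box_div i0 w (d D : k) : red_words i0 -> 0 < d <= D ->
  exists L0, forall L H, 0 < L -> L0 <= L -> in_box i0 (d * L) (D * L) H ->
    exists2 Z, calU Z & H = (Z * \pi_fU%qT w)%g.
Proof.
move=> red0; elim/last_ind: w d D => [|w [j t] IH] d D dD.
  exists 0 => L H _ _ [a -> _]; exists (fcoord i0 a); first by exists i0;
    split=> //; exists a.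
  by have -> : (fcoord i0 a * \pi_fU%qT [::] = fcoord i0 a)%g by apply:
    fU_mulr1.
have [i red [r ir]] := last_letter j.
have [d1 [D1 [/andP [d1_gt0 dD1] box1]]] := box_change red0 red dD.
(* Subtracting [t] from the last coordinate leaves at least half of the lower bound [d1 * L], since
   [L] is at least [2 * t / d1]. *)
have dD1' : 0 < d1 / 2 <= D1 by lra.
have [d2 [D2 [dD2 box2]]] := box_change red red0 dD1'.
have [L0 divw] := IH _ _ dD2.
exists (Num.max L0 (2 * pos_val t / d1)) => L H L_gt0.
rewrite ge_max ler_pdivrMr // => /andP [L0L tL] /(box1 _ _ L_gt0) [a -> aP].
have [m /(_ a) [u [uE setE]]] := last_word K ir.
have t_gt0 := pos_valP t.
have rest_gt0 : 0 < pos_val (a m) - pos_val t by have /andP [] := aP m; lra.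
have [|Z UZ ZE] := divw L (fcoord i (set_coord a m (Pos rest_gt0))) L_gt0 L0L.
  apply: box2 => //; eexists => // l; rewrite /set_coord.
  have /andP [lo hi] := aP l; have /andP [lo' hi'] := aP m.
  by case: eqP => _ /=; apply/andP; split; lra.
exists Z => //; rewrite pi_rcons mulgA -ZE !fcoordE uE setE !pi_rcons -mulgA
  gen_gen.
by congr (_ * fU_gen _ _ _)%g; apply: val_inj; rewrite /= subrK.
Qed.

(** [H] is multiplied in with [box_mul] and [H'] divided out with [box_div]. The quotient is
    rewritten along [i0], so that both multipliers use one reduced word. *)
Lemma left_ore i0 (H H' : fU) : red_words i0 ->
  exists a a' : 'I_nu -> K, (fcoord i0 a * H = fcoord i0 a' * H')%g.
Proof.
move=> red0; have [w ->] := fU_piP H; have [w' ->] := fU_piP H'.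
have dD : 0 < (1 : k) <= 1 by rewrite ltr01 lexx.
have [d [D [L1 [dD1 mulw]]]] := box_mul w red0 dD.
have [L2 divw] := box_div w' red0 dD1.
pose L := Num.max 1 (Num.max L1 L2).
have L_gt0 : 0 < L by rewrite lt_max ltr01.
have [||Z [i [red [b ->]]] ZE] :=
  divw L (fcoord i0 (fun=> Pos L_gt0 : K) * \pi_fU%qT w)%g L_gt0.
- by rewrite !le_max lexx !orbT.
- apply: mulw => //; first by rewrite !le_max lexx !orbT.
  by eexists => // l /=; rewrite mul1r lexx.
have [R [RE _]] := change red red0.
by exists (fun=> Pos L_gt0), (fun l => sfeval b (R l)); rewrite ZE RE.
Qed.

End LeftOre.

(** * Paths of flags *)

Section Distance.
Local Open Scope ring_scope.
Variables (X : Type) (V : set X) (E : X -> X -> Prop).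
Implicit Types B C D : X.

Lemma dist_le0 B : V B -> dist_le V E 0 B B.
Proof. by move=> VB; exists (fun=> B); split. Qed.

Lemma dist_leD m n B C D : dist_le V E m B C -> dist_le V E n C D ->
  dist_le V E (m + n) B D.
Proof.
move=> [p [p0 pm pV pE]] [q [q0 qn qV qE]].
exists (fun l => if (l <= m)%N then p l else q (l - m)%N); split=> //.
- case: ifP => [le|_]; last by rewrite addKn.
  have n0 : n = 0%N by lia.
  by rewrite n0 addn0 pm -q0 -qn n0.
- by move=> l le; case: ifP => [|lt]; [apply: pV | apply: qV; lia].
move=> l lt; have [le|lt'] := leqP l.+1 m; first by rewrite ltnW //; apply: pE.
have [lm|neq] := eqVneq l m; last first.
  have -> : (l <= m)%N = false by lia.
  by rewrite subSn; [apply: qE; lia | lia].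
by rewrite lm leqnn subSnn pm -q0; apply: qE; lia.
Qed.

Lemma dist_le1 B C : V B -> V C -> B = C \/ E B C -> dist_le V E 1 B C.
Proof.
move=> VB VC BC; exists (fun l => if l is 0%N then B else C); split=> //.
- by case.
- by case.
Qed.

Lemma dist_le_sym n B C : (forall B' C', E B' C' -> E C' B') ->
  dist_le V E n B C -> dist_le V E n C B.
Proof.
move=> symE [p [p0 pn pV pE]]; exists (fun l => p (n - l)%N); split.
- by rewrite subn0.
- by rewrite subnn.
- by move=> l _; apply: pV; apply: leq_subr.
move=> l lt; have nl : (n - l = (n - l.+1).+1)%N by lia.
by rewrite nl; case: (pE (n - l.+1)%N) => [|->|]; [lia | left | right;
  apply: symE].
Qed.

(** Connectedness asks for genuine edges, so stationary steps are dropped. *)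
Lemma dist_le_edges n B C : dist_le V E n B C ->
  exists m (p : nat -> X), [/\ p 0%N = B, p m = C, forall l, (l <= m)%N ->
    V (p l)
    & forall l, (l < m)%N -> E (p l) (p l.+1)].
Proof.
elim: n C => [|n IH] C [p [p0 pn pV pE]].
  by exists 0%N, p; split=> // l l0; apply: pV.
have [|m [q [q0 qm qV qE]]] := IH (p n).
  by exists p; split=> // l le; [apply: pV | apply: pE]; lia.
have [eq_n|En] := pE n (ltnSn n); first by exists m, q; split;
  rewrite // qm eq_n.
exists m.+1, (fun l => if (l <= m)%N then q l else C); split=> //.
- by rewrite ltnn.
- by move=> l _; case: ifP => [/qV // | _]; rewrite -pn; apply: pV.
move=> l; rewrite ltnS => le; rewrite le.
have [->|neq] := eqVneq l m; first by rewrite ltnn qm -pn.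
by rewrite ifT; [apply: qE; lia | lia].
Qed.

End Distance.

(** * From left multiplication in the monoid to paths along half circles *)

Section Paths.
Local Open Scope ring_scope.
Variables (I : finType) (gT : finGroupType) (s : I -> gT).
Variables (k : realFieldType) (Re : realType) (G : pinned_group Re s).
Local Notation K := (pos_semifield k).
Local Notation nu := (nu s).
Variables (T : I -> K -> fU s K -> fU s K) (phi : fU s K -> fU s K).
Hypothesis cox : coxeter_system s.
Hypothesis simply_laced :
  forall i j, i != j -> #[s i * s j]%g = 2%N \/ #[s i * s j]%g = 3%N.
Hypothesis isT : is_T T.
Hypothesis isphi : is_phi G phi.
Let exch := @exchange _ _ _ _ G cox.
Local Notation calU := (@calU _ _ s K).

Lemma calU_coords (H : fU s K) j : calU H -> exists a0 w,
  H = \pi_(fU s K)%qT ((j, a0) :: w) /\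
  forall c, T j c H = \pi_(fU s K)%qT ((j, sf_mul a0 c) :: w).
Proof.
move=> /(calU_head G cox simply_laced j) [i [a [red ij ->]]].
have [a0 [w [_ E scaleE]]] := scale_first_word a ij.
by exists a0, w; split=> [|c]; rewrite ?isT // fcoordE ?E ?scaleE.
Qed.

Lemma calU_T j c H : calU H -> calU (T j c H).
Proof.
move=> /(calU_head G cox simply_laced j) [i [a [red ij ->]]]; rewrite isT //.
by exists i; split=> //; eexists.
Qed.

Lemma T_one j H : calU H -> T j sf_one H = H.
Proof.
by move=> /(calU_coords j) [a0 [w [HE TE]]]; rewrite TE sf_mulr1 -HE.
Qed.

Lemma T_T j c c' H : calU H -> T j c (T j c' H) = T j (sf_mul c' c) H.
Proof.
move=> /(calU_head G cox simply_laced j) [i [a [red ij ->]]]; rewrite !isT //.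
congr fcoord; apply: funext => l; rewrite /scale_first.
by case: eqP => // _; rewrite sf_mulA.
Qed.

(** Adding [t] to the first coordinate [a0] amounts to multiplying it by [(t + a0) / a0]. *)
Lemma gen_mul_T j t H : calU H -> exists c, (fU_gen s j t * H)%g = T j c H.
Proof.
move=> /(calU_coords j) [a0 [w [HE TE]]].
exists (sf_mul (sf_add t a0) (sf_inv a0)).
by rewrite TE HE sf_mulKV !pi_cons mulgA gen_gen.
Qed.

Local Notation V := (flag_manifold phi).
Local Notation E := (flag_edge T phi).
Local Notation flag H := (H, phi H).

Lemma calU_phi H : calU H -> calU (phi H).
Proof.
move=> [i [red [a ->]]]; have [P [_ ->]] := isphi red.
by exists i; split=> //; eexists.
Qed.

Lemma flag_of_calU H : calU H -> V (flag H).
Proof. by move=> UH; split=> //; apply: calU_phi. Qed.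

Lemma dist_T j c H : calU H -> dist_le V E 1 (flag H) (flag (T j c H)).
Proof.
move=> UH; apply: dist_le1; try by apply: flag_of_calU => //; apply: calU_T.
(* By [phi_half_circle] the second component of the action is the image under [phi] of the first, so
   the orbit of a flag consists of flags. *)
have act c' : flag_act T j c' (flag H) = flag (T j c' H).
  by rewrite /flag_act /= (phi_half_circle cox simply_laced _ _ isT isphi UH).
have [|neq] := pselect (flag H = flag (T j c H)); first by left.
right; split=> //; exists j, [set flag_act T j a (flag H) | a in [set:
  K]]%classic.
split; first by exists (flag H) => //; apply: flag_of_calU.
  by exists sf_one => //; rewrite act T_one.
by exists c => //; rewrite act.
Qed.

Lemma flag_edge_sym B C : E B C -> E C B.
Proof.
by move=> [neq [i [A [circle AB AC]]]]; split; [exact: nesym | exists i, A].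
Qed.

Lemma dist_mul w H : calU H -> calU (\pi_(fU s K)%qT w * H)%g /\
  dist_le V E (size w) (flag H) (flag (\pi_(fU s K)%qT w * H)%g).
Proof.
move=> UH; elim: w => [|[j t] w [Uw dw]] /=.
  have -> : (\pi_(fU s K)%qT [::] * H)%g = H by apply: fU_mul1.
  by split=> //; apply: dist_le0; apply: flag_of_calU.
rewrite pi_cons -mulgA; have [c ->] := gen_mul_T j t Uw.
split; first exact: calU_T.
by rewrite -addn1; apply: dist_leD dw _; apply: dist_T.
Qed.

(* Both products of the Ore condition are taken along the same reduced word, so
   that its first letter accounts for a single edge. *)
Lemma flag_distance (j : I) H H' : calU H -> calU H' ->
  dist_le V E (2 * nu - 1) (flag H) (flag H').
Proof.
move=> UH UH'; have [i red ij] := red_word_head cox j.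
have [|j'|a [a' ore]] := @left_ore _ _ s k _ _ i H H' red.
- move=> i1 i2 red1 red2.
  have [R [RE homR _]] := change_word cox simply_laced exch red1 red2.
  by exists R; split=> [b|c b]; [apply: RE | apply: homR].
- exact: red_word_last cox j'.
have [a0 [w [sz wE _]]] := scale_first_word a ij.
have [a0' [w' [sz' wE' _]]] := scale_first_word a' ij.
move: ore; rewrite !fcoordE wE wE' !pi_cons -!mulgA.
have [UX dX] := dist_mul w UH; have [UX' dX'] := dist_mul w' UH'.
have [c ->] := gen_mul_T j a0 UX; have [c' ->] := gen_mul_T j a0' UX'.
(* Undoing the last scaling on the right shows that the two partial products, [nu.-1] steps away
   from [H] and [H'], lie on one half circle. *)
move=> /(congr1 (T j (sf_inv c'))).
rewrite !T_T // sf_mulrV T_one // => X'E.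
have nu_gt0 : (0 < nu)%N by rewrite -(size_tuple i); case: (tval i) ij.
have -> : (2 * nu - 1 = nu.-1 + (1 + nu.-1))%N by lia.
apply: dist_leD; first by rewrite -sz; apply: dX.
apply: dist_leD; first by apply: (dist_T j (sf_mul c (sf_inv c')) UX).
by rewrite X'E -sz'; apply: dist_le_sym dX'; apply: flag_edge_sym.
Qed.

End Paths.

Theorem theorem20 (I : finType) (gT : finGroupType) (s : I -> gT)
    (k : realFieldType) (Re : realType) (G : pinned_group Re s)
    (T : I -> pos_semifield k -> fU s (pos_semifield k) ->
         fU s (pos_semifield k))
    (phi : fU s (pos_semifield k) -> fU s (pos_semifield k)) :
  (0 < #|I|)%N -> simply_laced_weyl s -> is_T T -> is_phi G phi ->
  (forall B B', flag_manifold phi B -> flag_manifold phi B' ->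
     dist_le (flag_manifold phi) (flag_edge T phi) (2 * nu s - 1) B B') /\
  graph_connected (flag_manifold phi) (flag_edge T phi).
Proof.
move=> /card_gt0P [j _] [cox simply_laced] isT isphi.
have dist B B' : flag_manifold phi B -> flag_manifold phi B' ->
    dist_le (flag_manifold phi) (flag_edge T phi) (2 * nu s - 1) B B'.
  case: B B' => [H1 H2] [H1' H2'] [/= UH _ <-] [/= UH' _ <-].
  exact: flag_distance cox simply_laced isT isphi j _ _ UH UH'.
split=> // B B' VB VB'; exact: dist_le_edges (dist B B' VB VB').
Qed.
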